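(* Let $(R(m,d))_{m,d\in\mathbb{N}}$ be a family of ordered graphs with the properties described in the context. Then for every ordered graph $F$, \[ \rho_{<}(F) = \lim_{d \to \infty} \lim_{m \to \infty} \rho_{<}(F, R(m, d)). \]
   Context: An ordered graph is a graph whose vertex set carries a total order. An ordered graph $G$ contains (an ordered copy of) an ordered graph $F$ if there is an injective order-preserving map $V(F)\to V(G)$ sending edges of $F$ to edges of $G$; otherwise $G$ is $F$-free. For ordered graphs $F$ and $G$ (with $e(G)>0$), $\rho_{<}(F,G)=\max\{e(G')/e(G) : G'\subseteq G,\ G' \text{ is } F\text{-free}\}$, and the relative Turán density is $\rho_{<}(F)=\inf_G \rho_{<}(F,G)$ over all ordered graphs $G$. For distinct $x,y\in\{0,1\}^d$ let $\delta(x,y)=\min\{i : x_i\neq y_i\}$; $\{0,1\}^d$ is ordered lexicographically ($x<y$ iff $x_{\delta(x,y)}=0$). The set $\{0,1\}^d\times[m]$ is ordered lexicographically: $(x,i)<(y,j)$ iff $x<y$, or $x=y$ and $i<j$. Blocks are $B_x=\{x\}\times[m]$. An edge between $B_x$ and $B_y$ with $\delta(x,y)=\ell$ is a level-$\ell$ edge, and $e_\ell(G)$ is the number of level-$\ell$ edges of $G$. The family $R(m,d)$ (ordered graph on $\{0,1\}^d\times[m]$) satisfies: for every $d\in\mathbb{N}$ and $\varepsilon>0$, for all sufficiently large $m$, (i) for every $\ell\in[d]$, $(1-\varepsilon)2^{d-1}m^2\le e_\ell(R(m,d))\le(1+\varepsilon)2^{d-1}m^2$, and $(1-\varepsilon)d2^{d-1}m^2\le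 e(R(m,d))\le(1+\varepsilon)d2^{d-1}m^2$; (ii) for all distinct $x,y\in\{0,1\}^d$ and all $P\subseteq B_x$, $Q\subseteq B_y$ with $|P|,|Q|\ge m^{2/3}$, the number of edges of $R(m,d)$ between $P$ and $Q$ is at most $(1+\varepsilon)2^{-d+\delta(x,y)}|P||Q|$. (Such a family exists, e.g. from a suitable sample of the random graph in which $(x,i)(y,j)$ is an edge independently with probability $2^{-d+\delta(x,y)}$.) *)

(* Defs.v *)
From HB Require Import structures.
From mathcomp Require Import all_boot all_order all_algebra.
From mathcomp Require Import all_classical all_reals all_analysis.
Set Implicit Arguments. Unset Strict Implicit. Unset Printing Implicit Defensive.
Import Order.TTheory GRing.Theory Num.Theory.

Definition is_ograph (V : finType) (lt adj : rel V) : Prop :=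
  [/\ irreflexive lt, transitive lt,
      (forall x y, x != y -> lt x y || lt y x),
      symmetric adj & irreflexive adj].

Definition edgeset (V : finType) (lt adj : rel V) : {set V * V} :=
  [set p | lt p.1 p.2 && adj p.1 p.2].

Definition nedges (V : finType) (lt adj : rel V) : nat := #|edgeset lt adj|.

Definition adjE (V : finType) (E : {set V * V}) : rel V :=
  fun u v => ((u, v) \in E) || ((v, u) \in E).

Definition contains_in (W V : finType) (ltW adjW : rel W) (lt : rel V)
    (U : {set V}) (E : {set V * V}) : bool :=
  [exists f : {ffun W -> V},
    [&& injectiveb f,
        [forall a, f a \in U],
        [forall a, forall b, ltW a b ==> lt (f a) (f b)] &
        [forall a, forall b, adjW a b ==> adjE E (f a) (f b)]]].

Definition is_subgraph (V : finType) (lt adj : rel V) (U : {set V})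
    (E : {set V * V}) : bool :=
  (E \subset edgeset lt adj) && [forall p in E, (p.1 \in U) && (p.2 \in U)].

Definition max_free_edges (W V : finType) (ltW adjW : rel W) (lt adj : rel V)
  : nat :=
  \max_(UE : {set V} * {set V * V} |
          is_subgraph lt adj UE.1 UE.2 && ~~ contains_in ltW adjW lt UE.1 UE.2)
     #|UE.2|.

Definition rho (R : realType) (W V : finType) (ltW adjW : rel W)
    (lt adj : rel V) : R :=
  (max_free_edges ltW adjW lt adj)%:R / (nedges lt adj)%:R.

Definition rho_inf (R : realType) (W : finType) (ltW adjW : rel W) : R :=
  inf [set r : R | exists (V : finType) (lt adj : rel V),
         [/\ is_ograph lt adj, (0 < nedges lt adj)%N &
             r = rho R ltW adjW lt adj]].

(* x : {0,1}^d is a function 'I_d -> bool; coordinate i (0-based) is the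
   paper's coordinate i+1; [m] is represented by 'I_m. *)
Definition cube (d : nat) := {ffun 'I_d -> bool}.
Definition Vt (m d : nat) := (cube d * 'I_m)%type.

(* delta(x,y) = min { i in [d] : x_i <> y_i }  (1-based, as in the paper) *)
Definition delta (d : nat) (x y : cube d) : nat :=
  (find (fun i : 'I_d => x i != y i) (enum 'I_d)).+1.

Definition lexlt (d : nat) (x y : cube d) : bool :=
  [exists i : 'I_d, [&& x i != y i,
                        [forall j : 'I_d, (j < i)%N ==> (x j == y j)] &
                        ~~ x i]].

Definition vlt (m d : nat) : rel (Vt m d) :=
  fun u v => lexlt u.1 v.1 || ((u.1 == v.1) && (u.2 < v.2)%N).

Definition nedges_level (m d : nat) (adj : rel (Vt m d)) (l : nat) : nat :=
  #|[set p in edgeset (@vlt m d) adj | (p.1.1 != p.2.1) && (delta p.1.1 p.2.1 == l)]|.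

Definition nedges_between (m d : nat) (adj : rel (Vt m d)) (x y : cube d)
    (P Q : {set 'I_m}) : nat :=
  #|[set ij : 'I_m * 'I_m | [&& ij.1 \in P, ij.2 \in Q & adj (x, ij.1) (y, ij.2)]]|.

(* Main.v *)
(* For fixed d, rho(F, R(m,d)) tends to the largest total weight of a subgraph
   (U, E) of the complete graph on {0,1}^d, an edge xy weighing
   2^(delta(x,y) - d), that admits no weakly monotone homomorphism from F,
   divided by the weight d 2^(d-1) of all pairs.  Blowing up such a subgraph
   gives the lower bound.  For the upper bound, (i) and (ii) bound the cut norm
   of R(m,d) minus its expected density, so a dense H in R(m,d) leaves a heavy
   trace on a positive proportion of the transversals of the blocks, hence
   contains F-homomorphic traces there, and by Erdos' box theorem a copy of F.

   It remains to bound the weight of an F-free E on the cube by rho(F, G) + o(1)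
   for each ordered graph G.  Embed G in the cube as a random caterpillar: the
   vertices leave a random path at the levels l + k r, for random l and r.
   Every edge of G is then mapped to an almost uniform weighted pair, because
   conditioning a random bit string at the sparse random positions l + k r
   changes its law little in L^2.  Averaging, some embedding maps a
   wt(E) / (d 2^(d-1)) - o(1) proportion of the edges of G into E. *)

Require Import Defs.
From HB Require Import structures.
From mathcomp Require Import all_boot all_order all_fingroup all_algebra.
From mathcomp Require Import all_classical all_reals all_analysis.
From mathcomp Require Import ring lra zify.
Import Order.TTheory GRing.Theory Num.Theory numFieldNormedType.Exports.
Set Implicit Arguments. Unset Strict Implicit. Unset Printing Implicit Defensive.
Local Open Scope ring_scope.

(** * Cylinders and coordinate updates in finite products *)

Lemma card_cylinder (B : finType) (C : {set B}) (v : B -> bool) :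
  (#|[set w : {ffun B -> bool} | [forall b in C, w b == v b]]| * 2 ^ #|C|
   = 2 ^ #|B|)%N.
Proof.
pose F b := if b \in C then pred1 (v b) else predT.
have -> : #|[set w : {ffun B -> bool} | [forall b in C, w b == v b]]|
          = #|family F|.
  apply: eq_card => w; rewrite inE; apply/forall_inP/familyP => H b.
    by rewrite /F; case: ifP => // /H /eqP ->; rewrite inE.
  by move=> bC; have := H b; rewrite /F bC inE.
rewrite card_family foldrE big_map big_enum /=.
rewrite -[X in (_ * 2 ^ X)%N]sum1_card expn_sum [X in (_ * X)%N]big_mkcond.
rewrite -big_split /=.
rewrite (eq_bigr (fun=> 2%N)) ?prod_nat_const // => b _.
by rewrite /F; case: ifP => _; rewrite ?card1 ?card_bool.
Qed.

Definition upd (I A : finType) (z : {ffun I -> A}) (i : I) (a : A) :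
  {ffun I -> A} := [ffun j => if j == i then a else z j].

Lemma upd_id (I A : finType) (z : {ffun I -> A}) i a : upd z i a i = a.
Proof. by rewrite ffunE eqxx. Qed.

Lemma upd_neq (I A : finType) (z : {ffun I -> A}) i j a :
  j != i -> upd z i a j = z j.
Proof. by rewrite ffunE => /negbTE->. Qed.

Lemma updC (I A : finType) (z : {ffun I -> A}) i j a b : i != j ->
  upd (upd z i a) j b = upd (upd z j b) i a.
Proof.
move=> ij; apply/ffunP => k; rewrite !ffunE.
by case: eqVneq => // ->; rewrite eq_sym (negbTE ij).
Qed.

(** The map sending [(z, a)] to [(upd z i a, z i)] is an involution on pairs, so overwriting
    coordinate [i] by a uniform value preserves the uniform law. *)
Lemma sum_upd (R : pzSemiRingType) (I A : finType) (i : I)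
    (F : {ffun I -> A} -> R) :
  \sum_z \sum_a F (upd z i a) = #|A|%:R * \sum_z F z.
Proof.
rewrite pair_big /=.
pose t (p : {ffun I -> A} * A) := (upd p.1 i p.2, p.1 i).
have tK : involutive t.
  move=> [z a]; rewrite /t /= upd_id; congr (_, _); apply/ffunP => j.
  by rewrite !ffunE; case: eqVneq => [->|].
rewrite (reindex_inj (inv_inj tK)) /=.
rewrite (eq_bigr (fun p => F p.1)); last first.
  by move=> p _; congr F; have := tK p; rewrite /t /=; case: p => z a [].
rewrite -(pair_big xpredT xpredT (fun z _ => F z)) /= mulr_natl.
by rewrite exchange_big sumr_const.
Qed.

Lemma card_upd (I A : finType) (i : I) (S : {set {ffun I -> A}}) :
  (\sum_(z : {ffun I -> A}) #|[set a | upd z i a \in S]| = #|A| * #|S|)%N.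
Proof.
have := @sum_upd nat I A i (fun z => (z \in S)%N).
rewrite natn -[\sum_z (_ : nat)]/(\sum_z _)%N => E.
rewrite -[#|S|]sum1_card [in RHS]big_mkcond /=.
rewrite (eq_bigr (fun z => \sum_a (upd z i a \in S))%N) => [|z _]; last first.
  by rewrite -sum1_card big_mkcond; apply: eq_bigr => a _; rewrite inE; case: ifP.
apply: etrans E _; congr (_ * _)%N; apply: eq_bigr => z _; by case: ifP.
Qed.

(** * Erdos' box theorem *)

Lemma sum_card_exchange (X A : finType) (P : {set X}) (Q : {set A})
    (r : X -> A -> bool) :
  (\sum_(x in P) #|[set a in Q | r x a]| =
   \sum_(a in Q) #|[set x in P | r x a]|)%N.
Proof.
under eq_bigr => x _ do rewrite -sum1_card.
under [RHS]eq_bigr => x _ do rewrite -sum1_card.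
rewrite (exchange_big_dep (mem Q)) /=.
  by apply: eq_bigr => a aQ; apply: eq_bigl => x; rewrite !inE aQ.
by move=> x a _; rewrite inE => /andP[].
Qed.

(** For at least a [c / 2] share of the points [z], at least [c / 2 * #|A|] values of coordinate [i]
    lead into [S]. The elements of [A0] are then picked greedily: averaging over the values not yet
    chosen, each pick keeps a [c / 4] share of the surviving points. *)
Lemma dense_coordinate (R : realFieldType) (I A : finType) (i : I)
    (S : {set {ffun I -> A}}) (c : R) (k : nat) :
  0 < c -> (0 < #|A|)%N -> k%:R <= c / 4 * #|A|%:R ->
  c * #|{ffun I -> A}|%:R <= #|S|%:R ->
  exists2 A0 : {set A}, #|A0| = k &
    (c / 4) ^+ k * (c / 2) * #|{ffun I -> A}|%:R <=
      #|[set z : {ffun I -> A} | [forall a in A0, upd z i a \in S]]|%:R.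
Proof.
move=> c0 A0 => km dS.
set m : R := #|A|%:R in km *; pose T : finType := {ffun I -> A}; rewrite -/T in dS *.
have m0 : 0 < m by rewrite ltr0n.
pose row (z : T) := [set a | upd z i a \in S].
pose X0 := [set z : T | c / 2 * m <= #|row z|%:R].
have X0d : c / 2 * #|T|%:R <= #|X0|%:R.
  rewrite -(ler_pM2l m0).
  have H : m * #|S|%:R = \sum_z #|row z|%:R.
    by rewrite -natrM -(card_upd i) natr_sum.
  have : \sum_z #|row z|%:R <= \sum_(z : T) ((z \in X0)%:R * m + c / 2 * m).
    apply: ler_sum => z _; rewrite inE.
    case: (lerP (c / 2 * m) #|row z|%:R) => [_|/ltW h].
      rewrite /= mulr1n mul1r; have := max_card (mem (row z)).
      by rewrite -(ler_nat R) -/m => h; have := mulr_gt0 c0 m0; lra.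
    by rewrite /= mulr0n mul0r add0r.
  rewrite -H big_split /= -mulr_suml sumr_const.
  rewrite -[in X in X -> _](@natr_sum R) -big_mkcond /= ?sum1_card.
  rewrite -mulr_natr -/T -/m.
  by have := ler_wpM2l (ltW m0) dS; rewrite -/T; lra.
suff: forall j, (j <= k)%N -> exists2 B : {set A}, #|B| = j &
    (c / 4) ^+ j * (c / 2) * #|T|%:R <= #|[set z in X0 | B \subset row z]|%:R.
  case/(_ _ (leqnn k)) => B Bk HB; exists B => //; apply: le_trans HB _.
  rewrite ler_nat; apply: subset_leq_card; apply/fintype.subsetP => z.
  rewrite !inE => /andP[_ /fintype.subsetP H]; apply/forall_inP => a /H.
  by rewrite inE.
elim=> [_|j IH jk].
  exists finset.set0; rewrite ?cards0 // expr0 mul1r; apply: le_trans X0d _.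
  rewrite ler_nat; apply: subset_leq_card; apply/fintype.subsetP => z.
  by rewrite !inE finset.sub0set andbT.
have {IH}[B Bj HB] := IH (ltnW jk).
set Xj := [set z in X0 | B \subset row z] in HB *.
have jm : j.+1%:R <= c / 4 * m by apply: le_trans km; rewrite ler_nat.
(* At most [c / 4 * m] values are used up, so every surviving row still has [c / 4 * m] values
   outside [B]. *)
have cle : (c / 4) * #|Xj|%:R * m <=
   \sum_(a in ~: B) #|[set z in Xj | a \in row z]|%:R.
  rewrite -natr_sum -sum_card_exchange natr_sum.
  rewrite mulrAC mulrC mulr_natl -sumr_const; apply: ler_sum => z.
  rewrite !inE => /andP[zX0 BX].
  rewrite -[X in _ <= X]addr0 -(subrr (j%:R : R)) addrA addrAC.
  have : (#|row z| <= #|[set a in ~: B | a \in row z]| + j)%N.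
    rewrite -Bj addnC -cardsUI; apply: leq_trans (leq_addr _ _).
    apply: subset_leq_card; apply/fintype.subsetP => a; rewrite !inE => ->.
    by case: (a \in B).
  rewrite -(ler_nat R) natrD => h; rewrite -natr1 in jm; lra.
have [a0 a0B] : exists a0, a0 \notin B.
  have : (0 < #|~: B|)%N.
    rewrite cardsCs finset.setCK subn_gt0 Bj -(ltr_nat R) -/m.
    case: (lerP c 4) => c4.
      by rewrite -natr1 in jm; nra.
    have : c / 4 * m * #|T|%:R <= m * #|T|%:R.
      rewrite mulrAC mulrC; apply: ler_wpM2l; first exact: ltW.
      have : c * #|T|%:R <= #|T|%:R.
        by apply: le_trans dS _; rewrite ler_nat max_card.
      by have : 0 <= #|T|%:R :> R by []; nra.
    have T0 : 0 < #|T|%:R :> R.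
      by rewrite ltr0n card_ffun expn_gt0 A0.
    by rewrite (ler_pM2r T0) -natr1 in jm *; lra.
  by case/card_gt0P => a; rewrite inE; exists a.
pose cnt a := #|[set z in Xj | a \in row z]|.
case: (@arg_maxnP _ a0 (fun a => a \notin B) cnt a0B) => a aB amax.
exists (a |: B); first by rewrite cardsU1 aB Bj.
have aX : (c / 4) * #|Xj|%:R <= (cnt a)%:R.
  rewrite -(ler_pM2r m0); apply: le_trans cle _.
  apply: (@le_trans _ _ (\sum_(b in ~: B) (cnt a)%:R)).
    by apply: ler_sum => b; rewrite inE => bB; rewrite ler_nat; exact: amax.
  rewrite sumr_const -[leLHS]mulr_natr; apply: ler_wpM2l; first exact: ler0n.
  by rewrite ler_nat max_card.
apply: (@le_trans _ _ (cnt a)%:R).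
  rewrite exprS; apply: le_trans aX.
  have c4 : 0 <= c / 4 by lra.
  by have := ler_wpM2l c4 HB; rewrite !mulrA.
rewrite ler_nat; apply: subset_leq_card; apply/fintype.subsetP => z.
rewrite [in X in X -> _]inE => /andP[]; rewrite !inE => /andP[-> H] aS.
by rewrite finset.subUset finset.sub1set inE aS.
Qed.

(** The coordinates are treated one after another; [dense_coordinate] supplies [k] values for each
    and leaves a positive density that depends on neither [A] nor [S]. *)
Lemma dense_box (R : archiRealFieldType) (I : finType) (k : nat) (c : R) : 0 < c ->
  exists N : nat, forall (A : finType) (S : {set {ffun I -> A}}),
    (N <= #|A|)%N -> c * #|{ffun I -> A}|%:R <= #|S|%:R ->
    exists2 f : I -> {set A}, forall i, #|f i| = k &
      forall y : {ffun I -> A}, (forall i, y i \in f i) -> y \in S.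
Proof.
move=> c0.
(* The form needed for induction on the list of treated coordinates: for a positive proportion of
   [z], every point that lies in the box on these coordinates and agrees with [z] elsewhere is in
   [S]. *)
suff [N [c' c'0 H]] : exists N : nat, exists2 c' : R, 0 < c' &
    forall (A : finType) (S : {set {ffun I -> A}}),
    (N <= #|A|)%N -> c * #|{ffun I -> A}|%:R <= #|S|%:R ->
    exists2 f : I -> {set A}, forall i, i \in enum I -> #|f i| = k &
      c' * #|{ffun I -> A}|%:R <= #|[set z : {ffun I -> A} |
        [forall y : {ffun I -> A}, [forall i in enum I, y i \in f i] ==>
          [forall i, (i \notin enum I) ==> (y i == z i)] ==> (y \in S)]]|%:R.
  exists N.+1 => A S NA dS; have [f fk fS] := H A S (ltnW NA) dS.
  exists f => [i|y yf]; first by rewrite fk ?mem_enum.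
  have : 0 < c' * #|{ffun I -> A}|%:R.
    by rewrite mulr_gt0 // ltr0n card_ffun expn_gt0 (leq_trans _ NA).
  move=> /lt_le_trans /(_ fS); rewrite ltr0n => /card_gt0P[z].
  rewrite inE => /forallP/(_ y)/implyP H1; apply: (implyP (H1 _)).
    by apply/forall_inP => i _.
  by apply/forallP => i; rewrite mem_enum.
elim: (enum I) (enum_uniq I) => [_|i s IH /= /andP[ni us]].
  exists 0%N, c => // A S _ dS; exists (fun=> finset.set0) => //.
  apply: le_trans dS _; rewrite ler_nat; apply: subset_leq_card.
  apply/fintype.subsetP => z zS; rewrite inE; apply/forallP => y; apply/implyP => _.
  apply/implyP => /forallP H; suff -> : y = z by [].
  by apply/ffunP => j; apply/eqP; have := H j.
have [N [c' c'0 {}IH]] := IH us.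
exists (N + Num.bound (k%:R / (c' / 4))).+1; exists ((c' / 4) ^+ k * (c' / 2)).
  by rewrite mulr_gt0 ?exprn_gt0 //; lra.
move=> A S NA dS.
have [|f fk fS] := IH A S _ dS; first exact: leq_trans (leq_addr _ _) (ltnW NA).
set S' := finset _ in fS.
have [| |A0 A0k HA0] := dense_coordinate i (k := k) c'0 _ _ fS.
- exact: leq_trans NA.
- rewrite mulrC -ler_pdivrMr; last by lra.
  have k0 : 0 <= k%:R / (c' / 4) by rewrite divr_ge0 ?ler0n; last lra.
  apply: ltW; apply: lt_le_trans (archi_boundP k0) _.
  by rewrite ler_nat (leq_trans (leq_addl N _) (ltnW NA)).
exists (fun j => if j == i then A0 else f j).
  by move=> j; rewrite inE; case: eqVneq => //= _; exact: fk.
apply: le_trans HA0 _; rewrite ler_nat; apply: subset_leq_card.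
apply/fintype.subsetP => z; rewrite !inE => /forall_inP H.
apply/forallP => y; apply/implyP => /forall_inP yf; apply/implyP => /forallP yz.
have := yf i; rewrite inE eqxx => /(_ isT)/H.
rewrite inE => /forallP/(_ y)/implyP H1; apply: (implyP (H1 _)).
  apply/forall_inP => j js; have := yf j; rewrite inE js orbT => /(_ isT).
  by case: eqVneq js ni => // -> ->.
apply/forallP => j; apply/implyP => js; rewrite ffunE.
have [->//|ji] := eqVneq j i.
by have := yz j; rewrite inE negb_or ji js.
Qed.

(** * Conditioning on sparse random positions *)

Lemma card_cylinder_inj (B V : finType) (K : {set V}) (q : V -> B)
    (v : V -> bool) : {in K &, injective q} ->
  (#|[set w : {ffun B -> bool} | [forall k in K, w (q k) == v k]]| * 2 ^ #|K|
   = 2 ^ #|B|)%N.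
Proof.
move=> qI; pose v' b := [exists k in K, (q k == b) && v k].
have v'E k : k \in K -> v' (q k) = v k.
  move=> kK; apply/existsP/idP => [[l /and3P[lK /eqP /qI]]|vk].
    by move=> /(_ lK kK) ->.
  by exists k; rewrite kK eqxx.
rewrite -(card_cylinder (q @: K) v') card_in_imset //; congr (_ * _)%N.
apply: eq_card => w; rewrite !inE; apply/forall_inP/forall_inP => H.
  by move=> _ /imsetP[k kK ->]; rewrite v'E // H.
by move=> k kK; rewrite -(v'E _ kK) H // imset_f.
Qed.

Lemma sum_mem (R : pzSemiRingType) (T : finType) (P : pred T) :
  \sum_x (P x)%:R = #|[set x | P x]|%:R :> R.
Proof. by rewrite -natr_sum -sum1dep_card [in RHS]big_mkcond. Qed.

(* The right-hand side is the expectation of [h] times a density whose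
   variance, computed by pairing two indices [r], only comes from the few
   pairs whose positions collide. *)
Lemma sparse_conditioning (R : realFieldType) (B V J : finType) (K : {set V})
    (q : V -> J -> B) (v : V -> bool) (h : pred {ffun B -> bool}) (eta : R) :
  (forall r, {in K &, injective (q^~ r)}) ->
  {in K, forall k, injective (q k)} -> 0 < eta -> (0 < #|J|)%N ->
  #|J|%:R * #|[set w | h w]|%:R -
    2 ^+ #|B| / 2 * (eta * #|J|%:R + (#|K| ^ 2)%:R * 2 ^+ #|K| / eta) <=
  2 ^+ #|K| * \sum_r #|[set w | h w && [forall k in K, w (q k r) == v k]]|%:R.
Proof.
move=> qI qJ eta0 J0.
set W : R := #|J|%:R; set N : R := 2 ^+ #|B|; set c : R := 2 ^+ #|K|.
have W0 : 0 < W by rewrite ltr0n.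
have c0 : 0 < c by rewrite exprn_gt0.
have N0 : 0 < N by rewrite exprn_gt0.
pose P r (w : {ffun B -> bool}) := [forall k in K, w (q k r) == v k].
have cardN : #|{: {ffun B -> bool}}| = (2 ^ #|B|)%N by rewrite card_ffun card_bool.
have cardP r : #|[set w | P r w]|%:R * c = N.
  by rewrite /c /N -!natrX -natrM card_cylinder_inj.
pose coll r r' := [exists k in K, exists k' in K, q k r == q k' r'].
(* Without a collision the two events constrain [2 * #|K|] distinct bits and are independent; with
   one, the bound by a single event suffices. *)
have cardPP r r' : #|[set w | P r w && P r' w]|%:R * (c * c) <=
    N + (coll r r')%:R * (c * N).
  have [cl|ncl] := boolP (coll r r').
    rewrite mul1r; apply: (@le_trans _ _ (c * N)); last by rewrite lerDr ltW.
    rewrite mulrA mulrC; apply: ler_wpM2l; first exact: ltW.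
    rewrite -(cardP r); apply: ler_wpM2r; first exact: ltW.
    rewrite ler_nat.
    by apply: subset_leq_card; apply/fintype.subsetP => w; rewrite !inE => /andP[].
  rewrite mul0r addr0 le_eqVlt; apply/orP; left; apply/eqP.
  pose q2 (p : bool * V) := q p.2 (if p.1 then r else r').
  have := @card_cylinder_inj B _ (finset.setX finset.setT K) q2 (fun p => v p.2).
  rewrite cardsX finset.cardsT card_bool => H.
  rewrite /N /c -exprD addnn -mul2n -!natrX -natrM -H; last first.
    have ne k k' : k \in K -> k' \in K -> q k r != q k' r'.
      move=> kK k'K; apply: contra ncl => e; apply/existsP; exists k.
      by rewrite kK; apply/existsP; exists k'; rewrite k'K.
    move=> [[] k] [[] k']; rewrite !inE /q2 /= => kK k'K E.
    - by rewrite (qI r k k').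
    - by have := ne k k' kK k'K; rewrite E eqxx.
    - by have := ne k' k k'K kK; rewrite E eqxx.
    - by rewrite (qI r' k k').
  congr (_ * _)%:R; apply: eq_card => w; rewrite !inE.
  apply/andP/forall_inP => [[/forall_inP H1 /forall_inP H2] [[] k]|H1].
  - by rewrite !inE => kK; exact: H1.
  - by rewrite !inE => kK; exact: H2.
  by split; apply/forall_inP => k kK;
    [have := H1 (true, k)|have := H1 (false, k)]; rewrite !inE; apply.
(* For fixed [r'], [k] and [k'], at most one [r] collides, since [q k] is injective. *)
have cardcoll : \sum_r \sum_r' (coll r r')%:R <= (#|K| ^ 2)%:R * W.
  rewrite exchange_big /= mulr_natr -sumr_const; apply: ler_sum => r' _.
  rewrite -natr_sum ler_nat.
  apply: (@leq_trans (\sum_r \sum_(k in K) \sum_(k' in K) (q k r == q k' r'))).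
    apply: leq_sum => r _.
    have [/existsP[k /andP[kK /existsP[k']]]|//] := boolP (coll r r').
    case/andP => k'K e; rewrite (bigD1 k) //= (bigD1 k') //= e.
    exact: leq_trans (leq_addr _ _) (leq_addr _ _).
  rewrite exchange_big /=; under eq_bigr do rewrite exchange_big /=.
  apply: (@leq_trans (\sum_(k in K) \sum_(k' in K) 1)); last first.
    by rewrite !sum_nat_const muln1 expnS expn1.
  apply: leq_sum => k kK; apply: leq_sum => k' k'K.
  have [r0 /eqP e|no] := pickP (fun r => q k r == q k' r'); last first.
    by rewrite big1 // => r _; rewrite no.
  rewrite (bigD1 r0) //= big1 ?addn0 ?leq_b1 // => r rr0.
  by apply/eqP; rewrite eqb0; apply: contra rr0 => /eqP E; rewrite (qJ k kK r r0) // E.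
(* Divided by [W], this is a density of mean 1 for the uniform law. *)
pose G w := \sum_r c * (P r w)%:R.
have sumG : \sum_w G w = W * N.
  rewrite exchange_big /= (eq_bigr (fun=> N)) ?sumr_const ?mulr_natl // => r _.
  by rewrite -mulr_sumr sum_mem mulrC.
have sumGG : \sum_w G w ^+ 2 <= W * W * N + (#|K| ^ 2)%:R * W * (c * N).
  rewrite (eq_bigr (fun w => \sum_r \sum_r' c * c * (P r w && P r' w)%:R)).
    rewrite exchange_big /=; under eq_bigr do rewrite exchange_big /=.
    apply: (@le_trans _ _ (\sum_r \sum_r' (N + (coll r r')%:R * (c * N)))).
      apply: ler_sum => r _; apply: ler_sum => r' _.
      by rewrite -mulr_sumr sum_mem mulrC.
    under eq_bigr do rewrite big_split /= sumr_const -mulr_suml.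
    rewrite big_split /= sumr_const -mulr_suml.
    rewrite -mulrnA -[X in X + _]mulr_natl natrM -/W lerD2l.
    by apply: ler_wpM2r => //; rewrite mulr_ge0 // ltW.
  move=> w _; rewrite expr2 mulr_suml; apply: eq_bigr => r _.
  rewrite mulr_sumr; apply: eq_bigr => r' _.
  by rewrite mulrACA -natrM mulnb.
(* The pointwise inequality [- (a + x ^+ 2 / a) / 2 <= x] with [a = eta * W] stands in for
   Cauchy-Schwarz and avoids square roots. *)
have pt w : - (eta * W + (G w - W) ^+ 2 / (eta * W)) / 2 <= (h w)%:R * (G w - W).
  have a0 : 0 < eta * W by rewrite mulr_gt0.
  move: (G w - W) => x; set a := eta * W in a0 *.
  have : 0 <= (a + x) ^+ 2 / a by rewrite divr_ge0 ?sqr_ge0 ?ltW.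
  have -> : (a + x) ^+ 2 / a = a + 2 * x + x ^+ 2 / a by field; rewrite gt_eqF.
  have : 0 <= x ^+ 2 / a by rewrite divr_ge0 ?sqr_ge0 ?ltW.
  by case: (h w); rewrite ?mul1r ?mul0r; lra.
have : \sum_w - (eta * W + (G w - W) ^+ 2 / (eta * W)) / 2 <=
       \sum_w (h w)%:R * (G w - W) by apply: ler_sum => w _; exact: pt.
have -> : \sum_w (h w)%:R * (G w - W) =
    c * (\sum_r #|[set w | h w && P r w]|%:R) - W * #|[set w | h w]|%:R.
  rewrite -!sum_mem !mulr_sumr -sumrN /G.
  under eq_bigr do rewrite mulrBr mulr_sumr.
  rewrite big_split /= exchange_big /=; congr (_ + _).
    apply: eq_bigr => r _; rewrite -sum_mem mulr_sumr; apply: eq_bigr => w _.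
    by rewrite mulrCA -natrM mulnb.
  by apply: eq_bigr => w _; rewrite mulrC.
have -> : \sum_w - (eta * W + (G w - W) ^+ 2 / (eta * W)) / 2 =
   - (eta * W * N + (\sum_w G w ^+ 2 - W * W * N) / (eta * W)) / 2.
  rewrite -mulr_suml sumrN big_split /= sumr_const -mulr_suml.
  have -> : \sum_w (G w - W) ^+ 2 = \sum_w G w ^+ 2 - W * W * N.
    under eq_bigr do rewrite sqrrB.
    rewrite big_split big_split /= sumrN sumr_const sumrMnl -mulr_suml sumG.
    by rewrite cardN -[_ *+ (2 ^ _)]mulr_natr natrX -/N; ring.
  by rewrite cardN -[_ *+ (2 ^ _)]mulr_natr natrX -/N.
move=> H.
have : (\sum_w G w ^+ 2 - W * W * N) / (eta * W) <= (#|K| ^ 2)%:R * c * N / eta.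
  rewrite ler_pdivrMr ?mulr_gt0 //.
  have -> : (#|K| ^ 2)%:R * c * N / eta * (eta * W) = (#|K| ^ 2)%:R * W * (c * N).
    by field; rewrite gt_eqF.
  by lra.
by move: H; rewrite -/P; set X := \sum_r _; set Y := _ / (eta * W); lra.
Qed.

(** * The weighted cube *)

Lemma lexltP (d : nat) (x y : cube d) :
  reflect (exists i : 'I_d, [/\ x i = false, y i = true &
             forall j : 'I_d, (j < i)%N -> x j = y j]) (lexlt x y).
Proof.
apply: (iffP existsP) => -[i].
  case/and3P => xy /forallP H /negbTE xi; exists i; split=> //.
    by move: xy; rewrite xi; case: (y i).
  by move=> j ji; apply/eqP; have := H j; rewrite ji.
case=> xi yi H; exists i; rewrite xi yi /=; apply/andP; split=> //.
by apply/forallP => j; apply/implyP => /H ->.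
Qed.

Lemma delta_first (d : nat) (x y : cube d) (i : 'I_d) : x i != y i ->
  (forall j : 'I_d, (j < i)%N -> x j = y j) -> delta x y = i.+1.
Proof.
move=> xy H; rewrite /delta; congr _.+1.
set P := fun i : 'I_d => x i != y i.
have hP : has P (enum 'I_d) by apply/hasP; exists i; rewrite ?mem_enum.
have fd : (find P (enum 'I_d) < d)%N by rewrite -[X in (_ < X)%N]size_enum_ord -has_find.
case: (ltngtP (find P (enum 'I_d)) i) => // h.
  have := nth_find i hP; rewrite /P H ?eqxx //.
  by rewrite nth_enum_ord.
by have := before_find i h; rewrite nth_ord_enum /P xy.
Qed.

Lemma ex_first_diff (d : nat) (x y : cube d) : x != y ->
  exists2 i : 'I_d, x i != y i & forall j : 'I_d, (j < i)%N -> x j = y j.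
Proof.
move=> xy.
have [i0 i0P] : exists i, x i != y i.
  apply/existsP; apply: contraR xy; rewrite negb_exists => /forallP H.
  by apply/eqP/ffunP => i; apply/eqP; have := H i; rewrite negbK.
case: (@arg_minnP _ i0 (fun i => x i != y i) (fun i => i : nat) i0P) => i xyi Hi.
exists i => // j ji; apply/eqP; apply: contraTT ji => /Hi.
by rewrite -leqNgt.
Qed.

Lemma delta_le (d : nat) (x y : cube d) : x != y -> (delta x y <= d)%N.
Proof. by case/ex_first_diff => i xyi /(delta_first xyi) ->. Qed.

Lemma lexlt_irr (d : nat) : irreflexive (@lexlt d).
Proof. by move=> x; apply/lexltP => -[i [->]]. Qed.

Lemma lexlt_trans (d : nat) : transitive (@lexlt d).
Proof.
move=> y x z /lexltP[i [xi yi Hi]] /lexltP[j [yj zj Hj]]; apply/lexltP.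
case: (ltngtP i j) => ij.
- exists i; rewrite -Hj //; split=> // k ki; rewrite Hi // Hj //.
  exact: ltn_trans ij.
- exists j; rewrite Hi //; split=> // k kj; rewrite Hi ?Hj //.
  exact: ltn_trans ij.
- by have /ord_inj E := ij; rewrite -E yi in yj.
Qed.

Lemma lexlt_total (d : nat) (x y : cube d) : x != y -> lexlt x y || lexlt y x.
Proof.
case/ex_first_diff => i xyi H; apply/orP.
have [xi|xi] := boolP (x i); [right|left]; apply/lexltP; exists i;
  move: xyi; rewrite ?xi ?(negbTE xi); case: (y i) => //; split=> // j /H //.
Qed.

Lemma lexlt_neq (d : nat) (x y : cube d) : lexlt x y -> x != y.
Proof. by apply: contraTneq => ->; rewrite lexlt_irr. Qed.

Lemma lexlt_asym (d : nat) (x y : cube d) : lexlt x y -> lexlt y x = false.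
Proof.
move=> xy; have [yx|//] := boolP (lexlt y x).
by have := lexlt_trans xy yx; rewrite lexlt_irr.
Qed.

Lemma vlt_ograph (m d : nat) (adj : rel (Vt m d)) :
  symmetric adj -> irreflexive adj -> is_ograph (@vlt m d) adj.
Proof.
move=> sa ia; split=> //.
- by move=> u; rewrite /vlt lexlt_irr eqxx ltnn.
- move=> v u w /orP[uv|/andP[/eqP uv iv]] /orP[vw|/andP[/eqP vw jw]]; apply/orP.
  + by left; exact: lexlt_trans vw.
  + by left; rewrite -vw.
  + by left; rewrite uv.
  + by right; rewrite uv vw eqxx (ltn_trans iv jw).
- move=> [x i] [y j]; rewrite /vlt /=; have [<-|xy _] := eqVneq x y.
    rewrite lexlt_irr /= xpair_eqE eqxx /=.
    by case: (ltngtP i j) => // /ord_inj ->; rewrite eqxx.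
  rewrite /= !orbF; exact: lexlt_total.
Qed.

(** Monotonicity is weak because vertices of F placed in one block of R(m,d) project to the same
    point of the cube. Adjacent vertices stay apart as soon as [E] lies in [cube_edges]. *)
Definition weak_hom (W : finType) (ltF adjF : rel W) (d : nat)
    (U : {set cube d}) (E : {set cube d * cube d}) (f : {ffun W -> cube d}) :=
  [&& [forall a, f a \in U],
      [forall a, forall b, ltF a b ==> (f a == f b) || lexlt (f a) (f b)] &
      [forall a, forall b, adjF a b ==> adjE E (f a) (f b)]].

Definition cube_edges (d : nat) : {set cube d * cube d} :=
  [set e | lexlt e.1 e.2].

Definition hom_free (W : finType) (ltF adjF : rel W) (d : nat)
    (UE : {set cube d} * {set cube d * cube d}) : bool :=
  [&& UE.2 \subset cube_edges d,
      [forall e in UE.2, (e.1 \in UE.1) && (e.2 \in UE.1)] &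
      ~~ [exists f, weak_hom ltF adjF UE.1 UE.2 f]].

(** The asymptotic edge density of R(m,d) between the blocks of the two endpoints. *)
Definition edge_wt (R : realType) (d : nat) (e : cube d * cube d) : R :=
  2 ^+ delta e.1 e.2 / 2 ^+ d.

Definition wt (R : realType) (d : nat) (E : {set cube d * cube d}) : R :=
  \sum_(e in E) edge_wt R e.

(** The default 0 is attained when no pair is free, which happens if F has no vertices;
    [max_free_edges] is 0 in that case too. *)
Definition max_hom_free_wt (R : realType) (W : finType) (ltF adjF : rel W)
    (d : nat) : R :=
  \big[Order.max/0]_(UE | hom_free ltF adjF UE) wt R (d := d) UE.2.

Lemma edge_wt_gt0 (R : realType) (d : nat) (e : cube d * cube d) :
  0 < edge_wt R e.
Proof. by rewrite /edge_wt divr_gt0 ?exprn_gt0. Qed.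

Lemma edge_wt_le1 (R : realType) (d : nat) (e : cube d * cube d) :
  e.1 != e.2 -> edge_wt R e <= 1.
Proof.
move=> ne; rewrite /edge_wt ler_pdivrMr ?exprn_gt0 // mul1r.
by apply: ler_weXn2l; rewrite ?delta_le // ler1n.
Qed.

Lemma wt_ge0 (R : realType) (d : nat) (E : {set cube d * cube d}) : 0 <= wt R E.
Proof. by apply: sumr_ge0 => e _; exact: ltW (edge_wt_gt0 R e). Qed.

Lemma wt_subset (R : realType) (d : nat) (E E' : {set cube d * cube d}) :
  E \subset E' -> wt R E <= wt R E'.
Proof.
move=> /fintype.subsetP EE'; rewrite /wt big_mkcond [leRHS]big_mkcond /=.
apply: ler_sum => e _; have [/EE' ->//|_] := boolP (e \in E).
by case: ifP => // _; exact: ltW (edge_wt_gt0 R e).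
Qed.

Lemma le_max_hom_free_wt (R : realType) (W : finType) (ltF adjF : rel W)
    (d : nat) (UE : {set cube d} * {set cube d * cube d}) :
  hom_free ltF adjF UE -> wt R UE.2 <= max_hom_free_wt R ltF adjF d.
Proof. by move=> H; rewrite /max_hom_free_wt (bigD1 UE) //= le_max lexx. Qed.

Lemma max_hom_free_wt_ge0 (R : realType) (W : finType) (ltF adjF : rel W)
    (d : nat) : 0 <= max_hom_free_wt R ltF adjF d.
Proof.
apply: (@big_ind _ (fun x : R => 0 <= x)) => // [x y x0 y0|UE _].
  by rewrite le_max x0.
exact: wt_ge0.
Qed.

Lemma max_hom_free_wtP (R : realType) (W : finType) (ltF adjF : rel W)
    (d : nat) : max_hom_free_wt R ltF adjF d = 0 \/
  exists2 UE : {set cube d} * {set cube d * cube d}, hom_free ltF adjF UE &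
    max_hom_free_wt R ltF adjF d = wt R UE.2.
Proof.
apply: (@big_ind _ (fun x : R => x = 0 \/ exists2 UE : {set cube d} *
  {set cube d * cube d}, hom_free ltF adjF UE & x = wt R UE.2)); first by left.
  by move=> x y Hx Hy; rewrite /Order.max; case: ifP.
by move=> UE H; right; exists UE.
Qed.

(** * Random caterpillars in the cube *)

(* A bit string for the common path ([None]) and one for each vertex. *)
Definition bits (V : finType) (d : nat) := {ffun option V * 'I_d -> bool}.

Definition path_of (V : finType) (d : nat) (w : bits V d) : cube d :=
  [ffun t => w (None, t)].

(** Vertices that leave at increasing levels, each where the path has bit 1, get increasing
    branches: the earlier one takes bit 0 where the later one still follows the path. *)
Definition branch (V : finType) (d : nat) (w : bits V d) (v : V) (L : nat) :
  cube d :=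
  [ffun t : 'I_d => if (t < L)%N then w (None, t)
                    else if t == L :> nat then ~~ w (None, t) else w (Some v, t)].

Lemma branch_lt (V : finType) (d : nat) (w : bits V d) (v : V) (L : 'I_d) :
  w (None, L) -> lexlt (branch w v L) (path_of w).
Proof.
move=> wL; apply/lexltP; exists L; rewrite !ffunE ltnn eqxx wL; split=> // j jL.
by rewrite !ffunE jL.
Qed.

Lemma branch_path_delta (V : finType) (d : nat) (w : bits V d) (v : V)
    (L : 'I_d) : delta (branch w v L) (path_of w) = L.+1.
Proof.
apply: delta_first => [|j jL]; rewrite !ffunE ?ltnn ?eqxx ?jL //.
by case: (w _).
Qed.

(** The event prescribes the [d] bits of the path and the [d - L.+1] bits of [v] beyond [L]. With
    [delta a b = L.+1] these are [2 * d - delta a b] bits, so the probability is proportional to the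
    weight of the edge. *)
Lemma card_branch_pair (V : finType) (v : V) (d : nat) (a b : cube d)
    (L : 'I_d) : lexlt a b ->
  (#|[set w : bits V d | w (None, L) && ((branch w v L, path_of w) == (a, b))]|
    * 2 ^ (2 * d) =
   if delta a b == L.+1 then 2 ^ delta a b * 2 ^ #|{: option V * 'I_d}| else 0)%N.
Proof.
move=> ab; case: eqP => [dab|nd]; last first.
  rewrite (_ : finset _ = finset.set0) ?cards0 ?mul0n //.
  apply/setP => w; rewrite !inE; apply/negP => /andP[_ /eqP[ea eb]].
  by apply: nd; rewrite -ea -eb branch_path_delta.
have [i [ai bi Hi]] := lexltP _ _ ab.
have iL : i = L.
  apply: val_inj; apply: succn_inj; rewrite -dab.
  by rewrite (@delta_first d a b i) ?ai ?bi.
subst i.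
pose C := [set p : option V * 'I_d | (p.1 == None) || ((p.1 == Some v) && (L < p.2)%N)].
pose val (p : option V * 'I_d) := if p.1 is None then b p.2 else a p.2.
rewrite [X in (X * _)%N](_ : _ = #|[set w : bits V d | [forall p in C, w p == val p]]|).
  rewrite dab -(card_cylinder C val) mulnCA; congr (_ * _)%N.
  have -> : #|C| = (d + (d - L.+1))%N.
    rewrite /C (_ : finset _ = ((fun t : 'I_d => (None, t)) @: finset.setT) :|:
       ((fun t : 'I_d => (Some v, t)) @: [set t : 'I_d | (L < t)%N])).
      rewrite cardsU (_ : _ :&: _ = finset.set0) ?cards0 ?subn0; last first.
        apply/setP => p; rewrite !inE; apply/negP => /andP[].
        by case/imsetP => s _ -> /imsetP[].
      rewrite !card_imset ?finset.cardsT ?card_ord; try by [move=> s t []].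
      congr (_ + _)%N; rewrite -sum1dep_card -[RHS]muln1 -sum_nat_const_nat.
      by rewrite big_geq_mkord.
    apply/setP => -[p t]; rewrite !inE /=; apply/orP/orP => -[].
    - by move/eqP->; left; apply/imsetP; exists t.
    - case/andP => /eqP-> Lt; right; apply/imsetP; exists t => //.
      by rewrite inE.
    - by case/imsetP => s _ [-> _]; left.
    - by case/imsetP => s; rewrite inE => Ls [-> ->]; right; rewrite eqxx.
  rewrite -expnD; congr (2 ^ _)%N; have := ltn_ord L; lia.
apply: eq_card => w; rewrite !inE; apply/andP/forall_inP.
  case=> wL /eqP[ea eb] [[u|] t]; rewrite inE /= /val /=.
    case/andP => /eqP[->] Lt; rewrite -ea ffunE.
    by rewrite ltnNge ltnW //= gtn_eqF.
  by move=> _; rewrite -eb ffunE.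
move=> H.
have wb t : w (None, t) = b t by apply/eqP/(H (None, t)); rewrite inE.
split; first by rewrite wb bi.
apply/eqP; congr (_, _); apply/ffunP => t; rewrite ffunE wb //.
case: (ltngtP t L) => tL.
- by rewrite Hi.
- by apply/eqP/(H (Some v, t)); rewrite inE /= eqxx tL.
- by rewrite (ord_inj tL) bi ai.
Qed.

(** Each edge is hit at one level only, the one given by [delta]. Hence the pair formed by a branch
    at a random level and the path samples edges in proportion to their weight. *)
Lemma sum_branch_edges (R : realType) (V : finType) (v : V) (d : nat)
    (E : {set cube d * cube d}) : E \subset cube_edges d ->
  \sum_(L < d) #|[set w : bits V d |
      w (None, L) && ((branch w v L, path_of w) \in E)]|%:R * 2 ^+ d =
  2 ^+ #|{: option V * 'I_d}| * wt R E.
Proof.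
move=> /fintype.subsetP EC.
have pw : 2 ^+ d * 2 ^+ d = 2 ^+ (2 * d) :> R by rewrite -exprD; congr (_ ^+ _); lia.
have d0 : 2 ^+ d != 0 :> R by rewrite expf_neq0 ?pnatr_eq0.
apply: (mulIf d0); rewrite -mulr_suml -mulrA pw.
rewrite -natr_sum (eq_bigr (fun L : 'I_d => \sum_(e in E) #|[set w : bits V d |
  w (None, L) && ((branch w v L, path_of w) == e)]|)%N).
  rewrite exchange_big /= natr_sum mulr_suml /wt mulr_sumr mulr_suml.
  apply: eq_bigr => -[a b] /EC; rewrite inE /= => ab.
  rewrite -natrX -natrM big_distrl /=.
  rewrite (eq_bigr _ (fun L _ => card_branch_pair v L ab)) -big_mkcond /=.
  have [i xi /(delta_first xi) di] := ex_first_diff (lexlt_neq ab).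
  rewrite (big_pred1 i) => [|j]; last by rewrite di eqSS eq_sym.
  by rewrite natrM !natrX /edge_wt -mulrA divfK // mulrC.
move=> L _; rewrite -sum1dep_card.
under [RHS]eq_bigr do rewrite -sum1dep_card.
rewrite [RHS](exchange_big_dep (fun w : bits V d => w (None, L))) /=; last first.
  by move=> e w _ /andP[].
rewrite big_mkcondr /=; apply: eq_bigr => w wL.
case: ifP => [bE|nE]; last first.
  by rewrite big1 // => e /and3P[eE _ /eqP be]; rewrite be eE in nE.
rewrite (big_pred1 (branch w v L, path_of w)) // => e /=.
by rewrite wL /= eq_sym; case: eqP => [->|]; rewrite ?bE ?andbF.
Qed.

(** Whenever the path has bit 1 at the level of departure, as for half of the bit strings, branch
    and path form an edge. Applying [sum_branch_edges] to all edges then gives the total weight. *)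
Lemma wt_cube_edges (R : realType) (d : nat) :
  wt R (cube_edges d) = d%:R * 2 ^+ d.-1.
Proof.
have := @sum_branch_edges R unit tt d _ (subxx (cube_edges d)).
move/(congr1 (fun x => x * 2)).
rewrite -mulr_suml mulrAC mulr_suml.
set N : R := 2 ^+ #|_|.
rewrite (eq_bigr (fun=> N)) => [|L _]; last first.
  rewrite /N -natrX -(card_cylinder [set (None, L)] (fun=> true)) cards1 natrM.
  congr (_%:R * _); apply: eq_card => w; rewrite !inE.
  apply/andP/forall_inP => [[wL _] p|H].
    by rewrite !inE => /eqP->; rewrite wL.
  have wL : w (None, L) by apply/eqP/H; rewrite inE.
  by split=> //; exact: branch_lt.
rewrite sumr_const card_ord -[N *+ d]mulr_natl => H.
have N0 : N != 0 by rewrite expf_neq0 ?pnatr_eq0.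
apply: (mulfI N0); apply: (@mulIf _ 2); first by rewrite pnatr_eq0.
rewrite -H; case: (d) => [|d']; first by rewrite !mul0r mulr0 mul0r.
by rewrite exprS; ring.
Qed.

(** * Embedding an ordered graph along the random path *)

Definition rank_of (V : finType) (lt : rel V) (v : V) : nat := #|[set u | lt u v]|.

Lemma rank_of_lt (V : finType) (lt adj : rel V) (u v : V) :
  is_ograph lt adj -> lt u v -> (rank_of lt u < rank_of lt v)%N.
Proof.
case=> lt_irr lt_trans _ _ _ uv; apply: proper_card; apply/properP; split.
  by apply/fintype.subsetP => w; rewrite !inE => /lt_trans; apply.
by exists u; rewrite !inE ?lt_irr.
Qed.

Lemma rank_of_inj (V : finType) (lt adj : rel V) :
  is_ograph lt adj -> injective (rank_of lt).
Proof.
move=> og u v E; apply/eqP; case: (og) => _ _ tot _ _; apply: contraT => /tot.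
by case/orP => /(rank_of_lt og); rewrite E ltnn.
Qed.

Lemma rank_of_bound (V : finType) (lt adj : rel V) (v : V) :
  is_ograph lt adj -> (rank_of lt v < #|V|)%N.
Proof.
case=> lt_irr _ _ _ _; rewrite -cardsT; apply: proper_card; apply/properP.
by split; [exact: finset.subsetT | exists v; rewrite !inE ?lt_irr].
Qed.

(** Composing a copy of F in the pulled-back graph with [e] would give a weakly monotone
    homomorphism into [UE], so that graph is F-free. *)
Lemma pullback_edges_le (W V : finType) (ltF adjF : rel W) (lt adj : rel V)
    (d : nat) (UE : {set cube d} * {set cube d * cube d}) (e : V -> cube d) :
  hom_free ltF adjF UE -> (forall u v, lt u v -> lexlt (e u) (e v)) ->
  (#|[set p in edgeset lt adj | (e p.1, e p.2) \in UE.2]| <=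
   max_free_edges ltF adjF lt adj)%N.
Proof.
case: UE => U E /and3P[/= _ /forall_inP EU nhom] em.
set E' := finset _; pose U' := [set v | e v \in U].
have EE' u v : adjE E' u v -> adjE E (e u) (e v).
  by case/orP; rewrite inE => /andP[_ h]; apply/orP; [left | right].
apply: (@leq_bigmax_cond _ _ (fun UE : {set V} * {set V * V} => #|UE.2|) (U', E')).
apply/andP; split; first (apply/andP; split).
- by apply/fintype.subsetP => p; rewrite inE => /andP[].
- by apply/forall_inP => p; rewrite !inE => /andP[_ /EU].
apply: contra nhom => /existsP[f /and4P[_ /forallP fU /forallP fl /forallP fE]].
apply/existsP; exists [ffun a => e (f a)]; apply/and3P; split.
- by apply/forallP => a; have := fU a; rewrite inE ffunE.
- apply/forallP => a; apply/forallP => b; apply/implyP => ab.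
  by have /forallP/(_ b)/implyP/(_ ab)/em := fl a; rewrite !ffunE => ->; rewrite orbT.
apply/forallP => a; apply/forallP => b; apply/implyP => ab.
by have /forallP/(_ b)/implyP/(_ ab)/EE' := fE a; rewrite !ffunE.
Qed.

(** The level at which [v] leaves the path. The step of the progression is [r.+1], so that levels
    are distinct for [r = 0] as well. *)
Definition pos (V : finType) (lt : rel V) (l r : nat) (v : V) : nat :=
  (l + rank_of lt v * r.+1)%N.

(** This event makes every vertex branch off to the smaller side. The dimension is a successor so
    that [inord] applies; it is faithful once all positions are at most [d]. *)
Definition on_path (V : finType) (lt : rel V) (d l r : nat) (w : bits V d.+1) :=
  [forall v, w (None, inord (pos lt l r v))].

Lemma on_path_edges_le (W V : finType) (ltF adjF : rel W) (lt adj : rel V)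
    (d : nat) (UE : {set cube d.+1} * {set cube d.+1 * cube d.+1})
    (l r : nat) (w : bits V d.+1) : is_ograph lt adj ->
  (forall v, (pos lt l r v <= d)%N) -> hom_free ltF adjF UE ->
  on_path lt l r w ->
  (#|[set p in edgeset lt adj | (branch w p.1 (pos lt l r p.1),
                                 branch w p.2 (pos lt l r p.2)) \in UE.2]| <=
   max_free_edges ltF adjF lt adj)%N.
Proof.
move=> og pd hf /forallP wp.
apply: (pullback_edges_le (e := fun v => branch w v (pos lt l r v)) adj hf).
move=> u v uv.
have puv : (pos lt l r u < pos lt l r v)%N.
  by rewrite ltn_add2l ltn_mul2r /= (rank_of_lt og).
apply/lexltP; exists (inord (pos lt l r u)); rewrite !ffunE inordK ?ltnS //.
split; rewrite ?ltnn ?eqxx ?puv ?wp // => j jp; rewrite !ffunE jp.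
by rewrite (ltn_trans jp puv).
Qed.

(* The change of variables that turns the branch of [v] into the whole path. *)
Definition swap_after (V : finType) (d : nat) (v : V) (L : nat) (w : bits V d) :
  bits V d :=
  [ffun p : option V * 'I_d =>
     if (p.2 < L)%N then w p
     else if p.2 == L :> nat then (p.1 == None) (+) w p
     else w (tperm None (Some v) p.1, p.2)].

Lemma swap_afterK (V : finType) (d : nat) (v : V) (L : nat) :
  involutive (@swap_after V d v L).
Proof.
move=> w; apply/ffunP => -[p t]; rewrite !ffunE /=.
by case: (ltngtP t L) => //= _; rewrite ?addKb ?tpermK.
Qed.

(** Where the path bit for [k] is stored once [swap_after] has been applied at the position of [v]:
    beyond that level the strings of the path and of [v] are exchanged. *)
Definition free_pos (V : finType) (lt : rel V) (d : nat) (v k : V) (t : nat) :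
  option V * 'I_d.+1 :=
  (if (rank_of lt k <= rank_of lt v)%N then None else Some v, inord t).

(** The involution [swap_after] turns the branch of [v] into the path and leaves the branch of the
    earlier vertex [u] unchanged. A pair of branches thus becomes a branch and the path, conditioned
    on the bits that belong to the vertices other than [u]. *)
Lemma card_on_path_pair (V : finType) (lt adj : rel V) (d : nat) (u v : V)
    (E : {set cube d.+1 * cube d.+1}) (l r : nat) : is_ograph lt adj ->
  (forall k, (pos lt l r k <= d)%N) -> lt u v ->
  #|[set w : bits V d.+1 | on_path lt l r w &&
       ((branch w u (pos lt l r u), branch w v (pos lt l r v)) \in E)]| =
  #|[set w : bits V d.+1 | (w (None, inord (pos lt l r u)) &&
        ((branch w u (pos lt l r u), path_of w) \in E)) &&
      [forall k in [set~ u],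
         w (free_pos lt d v k (pos lt l r k)) == (k != v)]]|.
Proof.
move=> og pd uv; set L := pos lt l r v.
have ltp a b : (pos lt l r a < pos lt l r b)%N = (rank_of lt a < rank_of lt b)%N.
  by rewrite ltn_add2l ltn_mul2r.
have puv : (pos lt l r u < L)%N by rewrite ltp (rank_of_lt og).
have uNv : u != v.
  by case: og => lt_irr _ _ _ _; apply: contraTneq uv => ->; rewrite lt_irr.
pose t := @swap_after V d.+1 v L.
have tb : bijective t by exists t; exact: swap_afterK.
rewrite -(on_card_preimset (f := t) (onW_bij _ tb)); apply: eq_card => w; rewrite !inE.
have -> : branch (t w) u (pos lt l r u) = branch w u (pos lt l r u).
  apply/ffunP => i; rewrite !ffunE /=.
  case: (ltngtP i (pos lt l r u)) => iu.
  - by rewrite (ltn_trans iu puv).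
  - case: (ltngtP i L) => //= _; rewrite tpermD // eq_sym.
    by apply: contra uNv => /eqP[->].
  - by rewrite iu puv.
have -> : branch (t w) v L = path_of w.
  apply/ffunP => i; rewrite !ffunE /= tpermR.
  by case: (ltngtP i L) => // _; rewrite negbK.
(* The swap complements the path bit at the position of [v], hence the required value is [false]
   exactly for [k = v]. *)
have tE k : t w (None, inord (pos lt l r k)) =
    (w (free_pos lt d v k (pos lt l r k)) == (k != v)).
  rewrite ffunE /free_pos /= inordK ?ltnS // tpermL ltp.
  case: (ltngtP (rank_of lt k) (rank_of lt v)) => kv.
  - by case: (eqVneq k v) kv => [->|_ _]; rewrite ?ltnn //=; case: (w _).
  - rewrite gtn_eqF ?ltp //=.
    by case: (eqVneq k v) kv => [->|_ _]; rewrite ?ltnn //=; case: (w _).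
  - rewrite (rank_of_inj og kv) /L !eqxx /=; by case: (w _).
have uE : w (free_pos lt d v u (pos lt l r u)) = w (None, inord (pos lt l r u)).
  by rewrite /free_pos ltnW // (rank_of_lt og).
rewrite andbAC; congr (_ && _); apply/forallP/andP.
  move=> H; split; first by have := H u; rewrite tE uE uNv; case: (w _).
  by apply/forall_inP => k _; rewrite -tE.
case=> wu /forall_inP H k; rewrite tE.
have [->|ku] := eqVneq k u; first by rewrite uE wu uNv.
by apply: H; rewrite !inE.
Qed.

Definition on_path_pairs (V : finType) (lt : rel V) (d : nat)
    (E : {set cube d.+1 * cube d.+1}) (l r : nat) (p : V * V) : nat :=
  #|[set w : bits V d.+1 | on_path lt l r w &&
       ((branch w p.1 (pos lt l r p.1), branch w p.2 (pos lt l r p.2)) \in E)]|.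

(** What [on_path_pairs] becomes after the swap when only the bit of [u] remains prescribed;
    [sparse_conditioning] compares the two counts. *)
Definition branch_pairs (V : finType) (d : nat)
    (E : {set cube d.+1 * cube d.+1}) (u : V) (L : nat) : nat :=
  #|[set w : bits V d.+1 | w (None, inord L) &&
                           ((branch w u L, path_of w) \in E)]|.

Lemma pos_le (V : finType) (lt adj : rel V) (d W l r : nat) (v : V) :
  is_ograph lt adj -> (l < d.+1 - #|V| * W)%N -> (r < W)%N ->
  (pos lt l r v <= d)%N.
Proof.
move=> og ld rW; have := rank_of_bound v og; rewrite /pos => rv.
have : (rank_of lt v * r.+1 <= #|V| * W)%N by apply: leq_mul => //; exact: ltnW.
lia.
Qed.

(** For each on-path [w], the edges mapped into [UE.2] form an F-free graph, and the on-path [w]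
    form a cylinder on [#|V|] bits. *)
Lemma sum_on_path_pairs_le (W V : finType) (ltF adjF : rel W)
    (lt adj : rel V) (d n : nat)
    (UE : {set cube d.+1} * {set cube d.+1 * cube d.+1}) (l r : nat) :
  is_ograph lt adj -> hom_free ltF adjF UE ->
  (l < d.+1 - #|V| * n)%N -> (r < n)%N ->
  (\sum_(p in edgeset lt adj) on_path_pairs lt UE.2 l r p * 2 ^ #|V| <=
   max_free_edges ltF adjF lt adj * 2 ^ #|{: option V * 'I_d.+1}|)%N.
Proof.
move=> og hf ld rn; have pd v := pos_le v og ld rn.
have := @card_cylinder_inj (option V * 'I_d.+1)%type V finset.setT
  (fun v => (None, inord (pos lt l r v))) (fun=> true).
rewrite finset.cardsT => <-; last first.
  move=> u v _ _ [] /(congr1 (@nat_of_ord _)); rewrite !inordK ?ltnS //.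
  by move/addnI/eqP; rewrite eqn_mul2r /= => /eqP/(rank_of_inj og).
rewrite -big_distrl /= mulnA leq_mul2r; apply/orP; right.
pose P := [set w : bits V d.+1 | on_path lt l r w].
rewrite (eq_bigr (fun p => #|[set w in P | (branch w p.1 (pos lt l r p.1),
   branch w p.2 (pos lt l r p.2)) \in UE.2]|)) => [|p _]; last first.
  by apply: eq_card => w; rewrite !inE.
rewrite sum_card_exchange mulnC.
rewrite (_ : #|_| = #|P|); last first.
  apply: eq_card => w; rewrite !inE; apply/forall_inP/forallP => H v.
    by apply/eqP/H; rewrite inE.
  by move=> _; rewrite H.
rewrite -sum_nat_const; apply: leq_sum => w; rewrite inE => wp.
exact: on_path_edges_le hf wp.
Qed.

(** The position [L] of [u] is held fixed while [r] varies; the bits of the other [#|V|.-1] vertices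
    then sit at sparse random positions, as [sparse_conditioning] requires. *)
Lemma sum_on_path_pairs_ge (R : realType) (V : finType) (lt adj : rel V)
    (d n : nat) (E : {set cube d.+1 * cube d.+1}) (u v : V) (eta : R) :
  is_ograph lt adj -> lt u v -> 0 < eta -> (0 < n)%N ->
  \sum_(#|V| * n <= L < d.+1 - #|V| * n)
    (n%:R * (branch_pairs E u L)%:R -
     2 ^+ #|{: option V * 'I_d.+1}| / 2 *
       (eta * n%:R + (#|V|.-1 ^ 2)%:R * 2 ^+ #|V|.-1 / eta)) <=
  2 ^+ #|V|.-1 * \sum_(r < n) \sum_(0 <= l < d.+1 - #|V| * n)
      (on_path_pairs lt E l r (u, v))%:R.
Proof.
move=> og uv eta0 n0.
pose shift (r : nat) := (rank_of lt u * r.+1)%N.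
have ru := rank_of_bound u og; have rv := rank_of_bound v og.
have shift_le (r : 'I_n) : (shift r <= #|V| * n)%N.
  by apply: leq_mul; [exact: ltnW | exact: ltn_ord].
have cK : #|[set~ u]| = #|V|.-1 by rewrite cardsC1.
(* The summation index becomes [L], with [l = L - shift r]. Only levels for which this is valid for
   every [r] are kept; the discarded terms are nonnegative. *)
apply: (@le_trans _ _ (2 ^+ #|V|.-1 * \sum_(r < n)
   \sum_(#|V| * n <= L < d.+1 - #|V| * n)
      (on_path_pairs lt E (L - shift r) r (u, v))%:R)); last first.
  apply: ler_wpM2l; first by rewrite exprn_ge0.
  apply: ler_sum => r _; have sr := shift_le r.
  move: (shift r) sr => a sr; move: (#|V| * n)%N sr => s sr.
  have [big|small] := leqP (d.+1 - s)%N s.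
    by rewrite (big_geq big) sumr_ge0.
  rewrite -{1}(subnK sr) big_addn.
  under eq_bigr do rewrite addnK.
  rewrite [leRHS](@big_cat_nat _ _ _ (s - a)) /=; [|lia|lia].
  rewrite [X in _ <= _ + X](@big_cat_nat _ _ _ (d.+1 - s - a)) /=; [|lia|lia].
  by rewrite addrCA lerDl addr_ge0 // sumr_ge0.
rewrite exchange_big /= mulr_sumr !big_nat; apply: ler_sum => L /andP[L1 L2].
have Ls (r : 'I_n) : (shift r <= L)%N by exact: leq_trans (shift_le r) L1.
(* The position of [k] differs from [L] by [r.+1] times the difference of the ranks of [k] and [u],
   so for [k != u] it determines [r]. *)
pose q k (r : 'I_n) := free_pos lt d v k (pos lt (L - shift r) r k).
have posd k (r : 'I_n) : (pos lt (L - shift r) r k <= d)%N.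
  apply: (pos_le k og (W := n)) => //; exact: leq_ltn_trans (leq_subr _ _) L2.
have rank_inj := rank_of_inj og.
have := @sparse_conditioning R _ _ 'I_n [set~ u] q (fun k => k != v)
  (fun w => w (None, inord L) && ((branch w u L, path_of w) \in E)) eta _ _ eta0.
rewrite card_ord cK => /(_ _ _ n0) H.
apply: le_trans (H _ _) _.
- move=> r k k' _ _ /= [] _ /(congr1 (@nat_of_ord _)); rewrite !inordK ?ltnS //.
  by move/addnI/eqP; rewrite eqn_mul2r /= => /eqP/rank_inj.
- move=> k; rewrite !inE => ku r r' [] /(congr1 (@nat_of_ord _)).
  rewrite !inordK ?ltnS // /pos => E'; apply/val_inj.
  have : rank_of lt k != rank_of lt u by apply: contra ku => /eqP/rank_inj->.
  move: (Ls r) (Ls r') E'; rewrite /shift /=.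
  move: (rank_of lt k) (rank_of lt u) (r : nat) (r' : nat) => b c x y cx cy.
  move=> E' bc; nia.
apply: ler_wpM2l; first by rewrite exprn_ge0.
apply: ler_sum => r _; rewrite ler_nat; apply: eq_leq.
rewrite /on_path_pairs /= (card_on_path_pair E og (posd^~ r) uv).
have -> : pos lt (L - shift r) r u = L by rewrite /pos subnK.
by [].
Qed.

(** Dropping [s] levels at each end of the range loses at most all bit strings for each dropped
    level. *)
Lemma sum_branch_pairs_ge (R : realType) (V : finType) (d s : nat) (u : V)
    (E : {set cube d.+1 * cube d.+1}) :
  E \subset cube_edges d.+1 -> (2 * s <= d.+1)%N ->
  2 ^+ #|{: option V * 'I_d.+1}| * (wt R E / 2 ^+ d.+1 - 2 * s%:R) <=
  \sum_(s <= L < d.+1 - s) (branch_pairs E u L)%:R.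
Proof.
move=> EC sd; set N : R := 2 ^+ _.
have hN L : (branch_pairs E u L)%:R <= N.
  rewrite /N -natrX ler_nat; apply: leq_trans (max_card _) _.
  by rewrite card_ffun card_bool.
have sumN a b : \sum_(a <= L < b) (branch_pairs E u L)%:R <= (b - a)%:R * N.
  apply: (@le_trans _ _ (\sum_(a <= L < b) N)); first exact: ler_sum.
  by rewrite sumr_const_nat mulr_natl.
have d0 : 2 ^+ d.+1 != 0 :> R by rewrite expf_neq0 ?pnatr_eq0.
have := sum_branch_edges R u EC; rewrite -/N -mulr_suml.
move/(congr1 (fun x => x / 2 ^+ d.+1)); rewrite /= mulfK //.
rewrite (eq_bigr (fun L : 'I_d.+1 => (branch_pairs E u L)%:R)) => [|L _]; last first.
  by rewrite /branch_pairs inord_val.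
rewrite -(big_mkord xpredT (fun L => (branch_pairs E u L)%:R)).
rewrite (@big_cat_nat _ _ _ s) /=; [|lia|lia].
rewrite (@big_cat_nat _ _ _ (d.+1 - s)%N s) /=; [|lia|lia].
have := sumN 0%N s; have := sumN (d.+1 - s)%N d.+1.
rewrite subKn; last by lia.
rewrite subn0; move: (\sum_(s <= L < _) _) => X h1 h2 h3.
by rewrite mulrBr mulrA -h3; lra.
Qed.

(** Double counting of the edges of G mapped into [UE.2], over all [l], [r] and on-path [w]. The
    error [4 * (#|V| * n)] comes from the levels dropped at both ends, the rest from
    [sparse_conditioning]. *)
Lemma hom_free_wt_le (R : realType) (W V : finType) (ltF adjF : rel W)
    (lt adj : rel V) (d n : nat)
    (UE : {set cube d.+1} * {set cube d.+1 * cube d.+1}) (eta : R) :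
  is_ograph lt adj -> hom_free ltF adjF UE -> 0 < eta -> (0 < n)%N ->
  (0 < #|V|)%N -> (2 * (#|V| * n) <= d.+1)%N ->
  (nedges lt adj)%:R * (wt R UE.2 / 2 ^+ d) <=
  d.+1%:R * (max_free_edges ltF adjF lt adj)%:R +
  (nedges lt adj)%:R * (4 * (#|V| * n)%:R +
     d.+1%:R * (eta + (#|V|.-1 ^ 2)%:R * 2 ^+ #|V|.-1 / (eta * n%:R))).
Proof.
move=> og hf eta0 n0 V0 Vd.
set s := (#|V| * n)%N in Vd *; set e : R := (nedges lt adj)%:R.
set M : R := (max_free_edges _ _ _ _)%:R.
set C : R := (_ ^ 2)%:R * 2 ^+ _.
pose N : R := 2 ^+ #|{: option V * 'I_d.+1}|.
have N0 : 0 < N by rewrite exprn_gt0.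
have nR : 0 < n%:R :> R by rewrite ltr0n.
have EC : UE.2 \subset cube_edges d.+1 by case/and3P: hf.
pose S : R := \sum_(p in edgeset lt adj) (2 ^+ #|V| * \sum_(r < n)
  \sum_(0 <= l < d.+1 - s) (on_path_pairs lt UE.2 l r p)%:R).
have SU : S <= n%:R * (d.+1%:R * (M * N)).
  rewrite /S -mulr_sumr exchange_big /= mulr_sumr.
  apply: (@le_trans _ _ (\sum_(r < n) (d.+1%:R * (M * N)))); last first.
    by rewrite sumr_const card_ord -[leLHS]mulr_natl.
  apply: ler_sum => r _; rewrite exchange_big /= mulr_sumr.
  apply: (@le_trans _ _ (\sum_(0 <= l < d.+1 - s) (M * N))).
    rewrite !big_nat; apply: ler_sum => l /andP[_ ld].
    have := sum_on_path_pairs_le og hf ld (ltn_ord r).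
    rewrite -(ler_nat R) natrM natrX -/M -/N -big_distrl /= natrM natrX.
    by rewrite natr_sum mulrC.
  rewrite sumr_const_nat subn0 -[leLHS]mulr_natl; apply: ler_wpM2r.
    by rewrite mulr_ge0 ?ler0n ?ltW.
  by rewrite ler_nat leq_subr.
have SL : e * (2 * (n%:R * (N * (wt R UE.2 / 2 ^+ d.+1 - 2 * s%:R)) -
     d.+1%:R * (N / 2 * (eta * n%:R + C / eta)))) <= S.
  rewrite /e /nedges mulr_natl -sumr_const; apply: ler_sum => -[u v].
  rewrite inE /= => /andP[uv _].
  (* One factor 2 belongs to the bit of [u], which [branch_pairs] still prescribes; the others
     normalise the conditioning on the remaining vertices. *)
  have -> : 2 ^+ #|V| = 2 * 2 ^+ #|V|.-1 :> R by rewrite -exprS prednK.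
  rewrite -[leRHS]mulrA ler_pM2l //.
  apply: le_trans (sum_on_path_pairs_ge UE.2 og uv eta0 n0).
  rewrite big_split /= -mulr_sumr -/s sumr_const_nat -/C -/N.
  apply: lerD; first by rewrite ler_pM2l //; exact: sum_branch_pairs_ge.
  rewrite mulNrn lerN2 -[leLHS]mulr_natl.
  apply: ler_wpM2r; last by rewrite ler_nat -subnDA leq_subr.
  have C0 : 0 <= C by rewrite /C mulr_ge0 ?exprn_ge0 ?ler0n.
  have nC : 0 <= eta * n%:R + C / eta.
    exact: addr_ge0 (mulr_ge0 (ltW eta0) (ltW nR)) (divr_ge0 C0 (ltW eta0)).
  by rewrite mulr_ge0 // divr_ge0 // ltW.
have := le_trans SL SU; rewrite exprS => H.
have nN : 0 < n%:R * N by rewrite mulr_gt0.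
rewrite -(ler_pM2l nN) -subr_ge0.
rewrite -subr_ge0 in H.
have d0 : 2 ^+ d != 0 :> R by rewrite expf_neq0 ?pnatr_eq0.
apply: le_trans H _; rewrite le_eqVlt; apply/orP; left; apply/eqP.
by field; rewrite d0 !gt_eqF.
Qed.

Lemma max_hom_free_wt_le_rho (R : realType) (W V : finType)
    (ltF adjF : rel W) (lt adj : rel V) (eps : R) :
  is_ograph lt adj -> (0 < nedges lt adj)%N -> 0 < eps ->
  exists D : nat, forall d : nat, (D <= d)%N ->
    max_hom_free_wt R ltF adjF d <=
    (rho R ltF adjF lt adj + eps) * (d%:R * 2 ^+ d.-1).
Proof.
move=> og e0 eps0.
have rho0 : 0 <= rho R ltF adjF lt adj by rewrite divr_ge0 ?ler0n.
have V0 : (0 < #|V|)%N.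
  by case/card_gt0P: e0 => -[u v] _; apply/card_gt0P; exists u.
pose C : R := (#|V|.-1 ^ 2)%:R * 2 ^+ #|V|.-1.
have C0 : 0 <= C by rewrite mulr_ge0 ?exprn_ge0 ?ler0n.
pose eta := eps / 4; have eta0 : 0 < eta by rewrite divr_gt0.
(* This [n] makes the variance term at most [eta], and [d] will be large enough for the boundary
   term to be at most [eta * d]. Together with [eta] itself, three quarters of [eps] are spent. *)
pose n := (Num.bound (C / (eta * eta))).+1.
have nC : C / (eta * n%:R) <= eta.
  rewrite ler_pdivrMr ?mulr_gt0 ?ltr0n // mulrA mulrC -ler_pdivrMr ?mulr_gt0 //.
  have c0 : 0 <= C / (eta * eta) by rewrite divr_ge0 // mulr_ge0 // ltW.
  by apply/ltW/(lt_le_trans (archi_boundP c0)); rewrite ler_nat leqnSn.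
pose s := (#|V| * n)%N.
exists (2 * s + Num.bound (4 * s%:R / eta)).+1 => -[//|d] Dd.
have [->|[UE hf ->]] := max_hom_free_wtP R ltF adjF d.+1.
  apply: mulr_ge0; first exact: addr_ge0 rho0 (ltW eps0).
  by rewrite mulr_ge0 ?exprn_ge0 ?ler0n.
have sd : (2 * s <= d.+1)%N by move: Dd; move: (Num.bound _) => b; lia.
have := hom_free_wt_le og hf eta0 (ltn0Sn _) V0 sd.
rewrite -/n -/C -/s.
have sR : 4 * s%:R <= eta * d.+1%:R.
  rewrite [leRHS]mulrC -ler_pdivrMr //.
  have c0 : 0 <= 4 * s%:R / eta by apply: divr_ge0 (ltW eta0); rewrite mulr_ge0 ?ler0n.
  apply/ltW/(lt_le_trans (archi_boundP c0)); rewrite ler_nat.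
  by move: Dd; move: (Num.bound _) => b; lia.
set e : R := (nedges lt adj)%:R; set M : R := (max_free_edges _ _ _ _)%:R => H.
have eR : 0 < e by rewrite ltr0n.
have d0 : 0 < 2 ^+ d :> R by rewrite exprn_gt0.
rewrite /= mulrA -ler_pdivrMr // -(ler_pM2l eR).
apply: le_trans H _.
have -> : e * ((rho R ltF adjF lt adj + eps) * d.+1%:R) =
   d.+1%:R * M + e * (eps * d.+1%:R).
  by rewrite /rho -/e -/M; field; rewrite gt_eqF.
rewrite lerD2l ler_pM2l //.
have dR : 0 <= d.+1%:R :> R by [].
have := ler_wpM2l dR nC.
have -> : eps = 4 * eta by rewrite /eta; field.
move: (C / _) (d.+1%:R : R) dR sR => x y y0 sR; have := mulr_ge0 y0 (ltW eta0); lra.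
Qed.

(** * Cut norm of the random-like graphs *)

Definition cross_edges (m d : nat) (E : {set Vt m d * Vt m d})
    (e : cube d * cube d) : {set 'I_m * 'I_m} :=
  [set ij | ((e.1, ij.1), (e.2, ij.2)) \in E].

Lemma sum_cross_edges (m d : nat) (adj : rel (Vt m d))
    (E : {set Vt m d * Vt m d}) : E \subset edgeset (@vlt m d) adj ->
  (\sum_(e in cube_edges d) #|cross_edges E e| =
   #|[set p in E | p.1.1 != p.2.1]|)%N.
Proof.
move=> /fintype.subsetP EE.
pose g (p : Vt m d * Vt m d) := (p.1.1, p.2.1).
rewrite -[RHS]sum1_card (partition_big g (mem (cube_edges d))) /=; last first.
  move=> p; rewrite !inE => /andP[/EE]; rewrite inE /vlt => /andP[/orP[]//].
  by case/andP => ->.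
apply: eq_bigr => -[x y]; rewrite inE /= => xy; rewrite sum1dep_card.
pose f (ij : 'I_m * 'I_m) : Vt m d * Vt m d := ((x, ij.1), (y, ij.2)).
rewrite -(card_imset _ (f := f)); last by move=> [i j] [i' j'] [-> ->].
apply: eq_card => -[[x' i] [y' j]]; rewrite !inE /=; apply/imsetP/idP.
  by case=> -[i' j']; rewrite inE /= => h [-> -> -> ->]; rewrite h (lexlt_neq xy) eqxx.
case/andP => /andP[h _] /eqP[ex ey]; exists (i, j); rewrite ?inE /= ?ex ?ey //.
by rewrite -ex -ey.
Qed.

Lemma nedges_between_cross (m d : nat) (adj : rel (Vt m d)) (x y : cube d) :
  lexlt x y ->
  nedges_between adj x y finset.setT finset.setT =
  #|cross_edges (edgeset (@vlt m d) adj) (x, y)|.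
Proof. by move=> xy; apply: eq_card => ij; rewrite !inE /= /vlt /= xy. Qed.

Lemma sum_nedges_level (m d : nat) (adj : rel (Vt m d)) :
  (\sum_(1 <= l < d.+1) nedges_level adj l =
   \sum_(e in cube_edges d) nedges_between adj e.1 e.2 finset.setT finset.setT)%N.
Proof.
rewrite [RHS](eq_bigr (fun e => #|cross_edges (edgeset (@vlt m d) adj) e|)).
  rewrite (sum_cross_edges (subxx _)).
  set X := [set p in _ | _].
  rewrite (eq_bigr (fun l => \sum_(p in X) (l == delta p.1.1 p.2.1))%N).
    rewrite exchange_big -sum1_card /=; apply: eq_bigr => p; rewrite inE.
    case/andP => _ /delta_le; rewrite -ltnS => dp.
    rewrite (eq_bigr (fun l => if l == delta p.1.1 p.2.1 then 1 else 0)%N).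
      by rewrite -big_mkcond big_nat1_eq dp.
    by move=> l _; case: eqP.
  move=> l _; rewrite /nedges_level -sum1_card [LHS]big_mkcond [RHS]big_mkcond /=.
  apply: eq_bigr => p _; rewrite !inE andbA.
  by case: (_ && (_ != _)) => //=; rewrite eq_sym; case: eqP.
by move=> [x y]; rewrite inE => /nedges_between_cross.
Qed.

Lemma nedges_between_split (m d : nat) (adj : rel (Vt m d)) (x y : cube d)
    (P Q : {set 'I_m}) :
  (nedges_between adj x y finset.setT finset.setT <=
   nedges_between adj x y P Q + nedges_between adj x y (~: P) finset.setT +
   nedges_between adj x y P (~: Q))%N.
Proof.
rewrite /nedges_between.
set A := finset _; set B := finset _; set C := finset _; set D := finset _.
apply: leq_trans (leq_trans (subset_leq_card (_ : A \subset B :|: C :|: D)) _).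
- by [].
- apply/fintype.subsetP => ij; rewrite !inE /= => ->.
  by case: (ij.1 \in P); case: (ij.2 \in Q).
apply: leq_trans (leq_card_setU _ _) _; rewrite leq_add2r.
exact: leq_card_setU.
Qed.

Lemma nedges_between_le (m d : nat) (adj : rel (Vt m d)) (x y : cube d)
    (P Q : {set 'I_m}) : (nedges_between adj x y P Q <= #|P| * #|Q|)%N.
Proof.
rewrite -cardsX; apply: subset_leq_card; apply/fintype.subsetP => ij.
by rewrite !inE => /and3P[-> ->].
Qed.

(** After cubing, the claim only asks for [m >= eps ^- 3]. *)
Lemma powR_two_thirds_le (R : realType) (eps : R) : 0 < eps ->
  exists M : nat, forall m : nat, (M <= m)%N -> m%:R `^ (2 / 3) <= eps * m%:R.
Proof.
move=> eps0; exists (Num.bound (eps ^- 3)).+1 => m Mm.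
have e3 : 0 <= eps ^- 3 by rewrite invr_ge0 exprn_ge0 // ltW.
have m1 : eps ^- 3 <= m%:R.
  apply/ltW/(lt_le_trans (archi_boundP e3)); rewrite ler_nat; exact: ltnW.
have m0 : 0 <= m%:R :> R by [].
have p0 : 0 <= m%:R `^ (2 / 3) :> R by exact: powR_ge0.
rewrite -(@ler_pXn2r _ 3) ?nnegrE ?mulr_ge0 ?(ltW eps0) //.
rewrite -powR_mulrn // -powRrM divfK ?pnatr_eq0 //.
rewrite powR_mulrn // exprMn.
have : 1 <= eps ^+ 3 * m%:R by rewrite -ler_pdivrMl ?exprn_gt0 // mulr1.
have : 0 <= m%:R ^+ 2 :> R by rewrite exprn_ge0.
rewrite [m%:R ^+ 3]exprSr; move: (m%:R ^+ 2 : R) (eps ^+ 3) (m%:R : R) => a b c a0 h.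
nra.
Qed.

(** Closeness in cut norm, one pair of blocks at a time, to the constant density [edge_wt]. *)
Definition cut_close (R : realType) (m d : nat) (adj : rel (Vt m d)) (eps : R) :=
  forall (x y : cube d) (P Q : {set 'I_m}), lexlt x y ->
    `|(nedges_between adj x y P Q)%:R -
      edge_wt R (x, y) * #|P|%:R * #|Q|%:R| <= eps * m%:R ^+ 2.

(** One-sided bounds suffice: the upper bounds for all pairs, set against the lower bound for the
    total, force a lower bound for each full pair of blocks, and then for each rectangle inside it
    by subtraction. *)
Lemma cut_close_of_upper (R : realType) (m d : nat) (adj : rel (Vt m d))
    (eps : R) : 0 < eps -> eps <= 1 -> m%:R `^ (2 / 3) <= eps * m%:R ->
  (forall l : nat, (1 <= l <= d)%N ->
     (1 - eps) * (2 ^+ d.-1 * m%:R ^+ 2) <= (nedges_level adj l)%:R) ->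
  (forall (x y : cube d) (P Q : {set 'I_m}), x != y ->
     (m%:R `^ (2 / 3) <= #|P|%:R :> R) -> (m%:R `^ (2 / 3) <= #|Q|%:R :> R) ->
     (nedges_between adj x y P Q)%:R
       <= (1 + eps) * (2 ^+ (delta x y) / 2 ^+ d) * #|P|%:R * #|Q|%:R) ->
  cut_close adj ((2 * (d%:R * 2 ^+ d.-1) + 2) * eps) /\
  (1 - eps) * (d%:R * 2 ^+ d.-1) * m%:R ^+ 2 <= \sum_(e in cube_edges d)
    (nedges_between adj e.1 e.2 finset.setT finset.setT)%:R.
Proof.
move=> eps0 eps1 mle lev dens; set D : R := d%:R * 2 ^+ d.-1.
have m0 : 0 <= m%:R :> R by [].
have cP (P : {set 'I_m}) : #|P|%:R <= m%:R :> R.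
  by rewrite ler_nat -[X in (_ <= X)%N]card_ord max_card.
have c0 (P : {set 'I_m}) : 0 <= #|P|%:R :> R by [].
have tot : (1 - eps) * D * m%:R ^+ 2 <= \sum_(e in cube_edges d)
    (nedges_between adj e.1 e.2 finset.setT finset.setT)%:R.
  rewrite -natr_sum -sum_nedges_level natr_sum.
  apply: (@le_trans _ _ (\sum_(1 <= l < d.+1) (1 - eps) * (2 ^+ d.-1 * m%:R ^+ 2))).
    rewrite sumr_const_nat subn1 /= -[leRHS]mulr_natl /D.
    by rewrite le_eqVlt; apply/orP; left; apply/eqP; ring.
  by rewrite !big_nat; apply: ler_sum => l; rewrite ltnS; exact: lev.
split=> //.
have upper (x y : cube d) (P Q : {set 'I_m}) : lexlt x y ->
    (nedges_between adj x y P Q)%:R <=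
    edge_wt R (x, y) * #|P|%:R * #|Q|%:R + eps * m%:R ^+ 2.
  move=> /lexlt_neq xy; have p0 := edge_wt_gt0 R (x, y).
  have p1 := @edge_wt_le1 R d (x, y) xy.
  have pPQ : 0 <= edge_wt R (x, y) * #|P|%:R * #|Q|%:R.
    by rewrite !mulr_ge0 // ltW.
  have tr : (nedges_between adj x y P Q)%:R <= #|P|%:R * #|Q|%:R :> R.
    by rewrite -natrM ler_nat nedges_between_le.
  have PQm : #|P|%:R * #|Q|%:R <= m%:R * m%:R :> R by apply: ler_pM.
  have [Ps|Pl] := ltP (#|P|%:R : R) (m%:R `^ (2 / 3)).
    have : #|P|%:R * #|Q|%:R <= (eps * m%:R) * m%:R :> R.
      by apply: ler_pM => //; apply/ltW/(lt_le_trans Ps).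
    by move: tr pPQ; rewrite expr2; lra.
  have [Qs|Ql] := ltP (#|Q|%:R : R) (m%:R `^ (2 / 3)).
    have : #|P|%:R * #|Q|%:R <= m%:R * (eps * m%:R) :> R.
      by apply: ler_pM => //; apply/ltW/(lt_le_trans Qs).
    by move: tr pPQ; rewrite expr2; lra.
  apply: le_trans (dens x y P Q xy Pl Ql) _.
  rewrite -[2 ^+ _ / _]/(edge_wt R (x, y)) !mulrDl mul1r lerD2l.
  move: (edge_wt R (x, y)) p0 p1 => p p0 p1; rewrite -!mulrA.
  apply: ler_wpM2l; first exact: ltW.
  by rewrite expr2; apply: le_trans PQm; rewrite ler_piMl // mulr_ge0.
(* The other pairs are bounded from above, so the total leaves at least this much for the blocks of
   [x] and [y]. *)
have full (x y : cube d) : lexlt x y ->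
    (edge_wt R (x, y) - 2 * eps * D) * m%:R ^+ 2 <=
    (nedges_between adj x y finset.setT finset.setT)%:R.
  move=> xy; move: tot; rewrite (bigD1 (x, y)) ?inE //=.
  set rest := \sum_(_ in _ | _) _ => tot.
  have : rest <= (1 + eps) * (D - edge_wt R (x, y)) * m%:R ^+ 2.
    rewrite /D -wt_cube_edges /wt (bigD1 (x, y)) ?inE //= [edge_wt _ _ + _]addrC addrK.
    rewrite mulr_sumr mulr_suml; apply: ler_sum => -[a b] /= /andP[].
    rewrite inE /= => ab _.
    have Tm : m%:R `^ (2 / 3) <= #|[set: 'I_m]|%:R :> R.
      rewrite finset.cardsT card_ord; apply: le_trans mle _.
      by rewrite ler_piMl.
    have := dens a b _ _ (lexlt_neq ab) Tm Tm.
    by rewrite finset.cardsT card_ord expr2 -!mulrA.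
  have : 0 <= eps * m%:R ^+ 2 * edge_wt R (x, y).
    by rewrite !mulr_ge0 ?exprn_ge0 // ltW // edge_wt_gt0.
  move: tot; move: (edge_wt R (x, y)) (m%:R ^+ 2 : R) => p mm tot; lra.
move=> x y P Q xy; rewrite ler_norml.
have D0 : 0 <= D by rewrite mulr_ge0 ?exprn_ge0.
have mm0 : 0 <= eps * m%:R ^+ 2 by rewrite mulr_ge0 ?exprn_ge0 // ltW.
have Dmm0 := mulr_ge0 D0 mm0.
apply/andP; split; last first.
  by have := upper x y P Q xy; lra.
(* For the lower bound, the complement of [P] times [Q] is cut into two rectangles bounded from
   above; they cause the summand 2 in the constant. *)
have := upper x y (~: P) finset.setT xy.
have := upper x y P (~: Q) xy.
have := full x y xy.
have := nedges_between_split adj x y P Q.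
rewrite -(ler_nat R) !natrD !finset.cardsT !card_ord.
have cC (S : {set 'I_m}) : #|~: S|%:R = m%:R - #|S|%:R :> R.
  by apply/eqP; rewrite eq_sym subr_eq -natrD addnC cardsC card_ord.
rewrite !cC.
by rewrite !expr2; lra.
Qed.

(** * Counting transversals *)

Lemma sum_upd2 (R : pzSemiRingType) (I A : finType) (x y : I)
    (F : {ffun I -> A} -> R) :
  \sum_z \sum_a \sum_b F (upd (upd z x a) y b) = #|A|%:R ^+ 2 * \sum_z F z.
Proof.
rewrite (sum_upd x (fun z => \sum_b F (upd z y b))) (sum_upd y F).
by rewrite expr2 mulrA.
Qed.

(* [f] and [h] become indicators of sets of values of [z x] and [z y] once the
   other coordinates are frozen, so the cut norm applies. *)
Lemma decouple_pair (R : realType) (m d : nat) (adj : rel (Vt m d)) (eps : R)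
    (x y : cube d) (f h : {ffun cube d -> 'I_m} -> bool) :
  (0 < m)%N -> cut_close adj eps -> lexlt x y ->
  (forall z b, f (upd z y b) = f z) -> (forall z a, h (upd z x a) = h z) ->
  `|\sum_z (f z && h z)%:R * ((adj (x, z x) (y, z y))%:R - edge_wt R (x, y))|
    <= eps * #|{: {ffun cube d -> 'I_m}}|%:R.
Proof.
move=> m0 cc xy fy hx; pose F (z : {ffun cube d -> 'I_m}) : R :=
  (f z && h z)%:R * ((adj (x, z x) (y, z y))%:R - edge_wt R (x, y)).
rewrite -[\sum_z _]/(\sum_z F z).
have mR : 0 < m%:R ^+ 2 :> R by rewrite exprn_gt0 ?ltr0n.
have := sum_upd2 x y F; rewrite card_ord => /(congr1 Num.norm).
rewrite normrM (gtr0_norm mR) => E; rewrite -(ler_pM2l mR) -E {E}.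
apply: le_trans (ler_norm_sum _ _ _) _.
rewrite mulrA mulr_natr -sumr_const; apply: ler_sum => z _.
pose P := [set a | f (upd z x a)]; pose Q := [set b | h (upd z y b)].
rewrite [_ * eps]mulrC; have := cc x y P Q xy; congr (`|_| <= _).
have FE a b : F (upd (upd z x a) y b) =
    ((a \in P) && (b \in Q) && adj (x, a) (y, b))%:R -
    edge_wt R (x, y) * ((a \in P)%:R * (b \in Q)%:R).
  rewrite /F fy updC ?lexlt_neq // hx !inE -updC ?lexlt_neq // upd_id.
  rewrite upd_neq ?lexlt_neq // upd_id.
  by case: (f _); case: (h _); case: (adj _ _); rewrite /=; lra.
under [RHS]eq_bigr do under eq_bigr do rewrite FE.
under [RHS]eq_bigr do rewrite sumrB -mulr_sumr -mulr_sumr.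
rewrite sumrB -mulr_sumr -mulr_suml -!mulrA; congr (_ - _ * _).
  rewrite pair_big /= sum_mem; congr _%:R; apply: eq_card => ij.
  by rewrite !inE andbA.
have cS (S : {set 'I_m}) : \sum_i (i \in S)%:R = #|S|%:R :> R.
  by rewrite sum_mem (eq_card (B := mem S)) // => i; rewrite inE.
by rewrite !cS.
Qed.

Definition all_pairs (I A : finType) (r : I * I -> A -> A -> bool)
    (s : seq (I * I)) (z : {ffun I -> A}) : bool :=
  all (fun e => r e (z e.1) (z e.2)) s.

(* Telescoping: replace the constraints [e \in s] by their densities one by
   one.  The remaining constraints split into those avoiding each endpoint. *)
Lemma replace_by_density (R : realType) (m d : nat) (adj : rel (Vt m d))
    (eps : R) (r : cube d * cube d -> 'I_m -> 'I_m -> bool)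
    (s t : seq (cube d * cube d)) :
  (0 < m)%N -> cut_close adj eps -> uniq (s ++ t) ->
  {in s ++ t, forall e, lexlt e.1 e.2} ->
  {in s, forall e, r e = fun i j => adj (e.1, i) (e.2, j)} ->
  `|\sum_z (all_pairs r (s ++ t) z)%:R -
    (\prod_(e <- s) edge_wt R e) * \sum_z (all_pairs r t z)%:R| <=
  (size s)%:R * eps * #|{: {ffun cube d -> 'I_m}}|%:R.
Proof.
move=> m0 cc; elim: s => [_ _ _|[x y] s IH] /=.
  by rewrite big_nil mul1r subrr normr0 !mul0r.
case/andP => xyN us lexs rs; set T : R := #|_|%:R in IH *.
have xy : lexlt x y by exact: (lexs (x, y) (mem_head _ _)).
have lexs' e : e \in s ++ t -> lexlt e.1 e.2.
  by move=> es; apply: lexs; rewrite inE es orbT.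
have {}IH := IH us lexs'
  (fun e es => rs e (@mem_behead _ ((x, y) :: s) e es)).
pose f (z : {ffun cube d -> 'I_m}) :=
  all (fun e => (y \notin [:: e.1; e.2]) ==> r e (z e.1) (z e.2)) (s ++ t).
pose h (z : {ffun cube d -> 'I_m}) :=
  all (fun e => (y \in [:: e.1; e.2]) ==> r e (z e.1) (z e.2)) (s ++ t).
have fh z : all_pairs r (s ++ t) z = f z && h z.
  rewrite /f /h -all_predI; apply: eq_all => e /=.
  by case: (y \in _); rewrite /= ?andbT.
have fy z b : f (upd z y b) = f z.
  apply: eq_all => e; rewrite !inE negb_or.
  case: eqVneq => //= y1; case: eqVneq => //= y2.
  by rewrite !upd_neq // eq_sym.
(* A pair in [s ++ t] containing both [x] and [y] would be [(x, y)], excluded by uniqueness, or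
   [(y, x)], excluded by the order. *)
have hx z a : h (upd z x a) = h z.
  apply: eq_in_all => -[e1 e2] es; rewrite !inE /=.
  have elt : lexlt e1 e2 := lexs' (e1, e2) es.
  have ne : (e1, e2) != (x, y) by apply: contraNneq xyN => <-.
  have xNy := lexlt_neq xy.
  have [ye|ye] := eqVneq y e1; rewrite /=.
    rewrite !upd_neq // -?ye; last by rewrite eq_sym.
    by apply/eqP => e2x; rewrite -ye e2x lexlt_asym in elt.
  have [ye2|//] := eqVneq y e2; rewrite /=.
  rewrite !upd_neq // -?ye2; first by rewrite eq_sym.
  by apply/eqP => e1x; rewrite e1x -ye2 eqxx in ne.
have step := decouple_pair m0 cc xy fy hx.
have rxy : r (x, y) = fun i j => adj (x, i) (y, j) by rewrite (rs _ (mem_head _ _)).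
set X := \sum_z (all_pairs r ((x, y) :: s ++ t) z)%:R.
set Y := \sum_z (all_pairs r (s ++ t) z)%:R in IH *.
have stepE : X - edge_wt R (x, y) * Y =
  \sum_z (f z && h z)%:R * ((adj (x, z x) (y, z y))%:R - edge_wt R (x, y)).
  rewrite /X /Y mulr_sumr -sumrB; apply: eq_bigr => z _.
  have -> : all_pairs r ((x, y) :: s ++ t) z =
      adj (x, z x) (y, z y) && all_pairs r (s ++ t) z.
    by rewrite /all_pairs /= rxy.
  by rewrite -fh; case: (adj _ _); case: (all_pairs _ _ _); rewrite /=; lra.
rewrite -stepE in step; rewrite big_cons -natr1.
have p0 := edge_wt_gt0 R (x, y); have p1 := @edge_wt_le1 R d (x, y) (lexlt_neq xy).
move: IH step; rewrite -/T; set Z := \sum_z _; set p := edge_wt R (x, y) in p0 p1 *.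
move: (\prod_(_ <- _) _) => q; rewrite !ler_norml => /andP[h1 h2] /andP[h3 h4].
have B0 : 0 <= (size s)%:R * eps * T by lra.
have k1 : p * (- ((size s)%:R * eps * T)) <= p * (Y - q * Z) by rewrite ler_pM2l.
have k2 : p * (Y - q * Z) <= p * ((size s)%:R * eps * T) by rewrite ler_pM2l.
have k3 : p * ((size s)%:R * eps * T) <= (size s)%:R * eps * T by rewrite ler_piMl.
rewrite -mulrA; apply/andP; split; lra.
Qed.

(** Here [z] is a transversal, one vertex in each block, and the graph that [E] induces on it is
    read on the cube. *)
Definition trace_edges (m d : nat) (E : {set Vt m d * Vt m d})
    (z : {ffun cube d -> 'I_m}) : {set cube d * cube d} :=
  [set e in cube_edges d | ((e.1, z e.1), (e.2, z e.2)) \in E].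

Lemma sum_pair_indicator (R : realType) (m d : nat) (e : cube d * cube d)
    (r : 'I_m -> 'I_m -> bool) : e.1 != e.2 ->
  m%:R ^+ 2 * \sum_(z : {ffun cube d -> 'I_m}) (r (z e.1) (z e.2))%:R =
  #|[set ij | r ij.1 ij.2]|%:R * #|{: {ffun cube d -> 'I_m}}|%:R :> R.
Proof.
move=> ne; have := sum_upd2 e.1 e.2
  (fun z : {ffun cube d -> 'I_m} => (r (z e.1) (z e.2))%:R : R).
rewrite card_ord => <-; rewrite mulr_natr -sumr_const; apply: eq_bigr => z _.
under eq_bigr do under eq_bigr do rewrite upd_id upd_neq // upd_id.
by rewrite pair_big /= sum_mem.
Qed.

(** The weight of the trace is averaged over the transversals that are complete in R(m,d). Given
    completeness, an edge [e] is in the trace with probability about [#|cross_edges E e| / m ^ 2]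
    divided by [edge_wt e], so the weights cancel and the mean is about the number of cross edges
    over [m ^ 2]. As no trace weighs more than [d * 2 ^ d.-1], many exceed [g]. *)
Lemma many_heavy_traces (R : realType) (m d : nat) (adj : rel (Vt m d))
    (E : {set Vt m d * Vt m d}) (eps g gap : R) : (0 < m)%N ->
  cut_close adj eps -> E \subset edgeset (@vlt m d) adj -> 0 <= g -> 0 <= eps ->
  (g + gap) * m%:R ^+ 2 <= #|[set p in E | p.1.1 != p.2.1]|%:R ->
  (\prod_(e in cube_edges d) edge_wt R e * gap -
    (d%:R * 2 ^+ d.-1 + g) * (#|cube_edges d|%:R * eps)) *
    #|{: {ffun cube d -> 'I_m}}|%:R <=
  d%:R * 2 ^+ d.-1 *
    #|[set z : {ffun cube d -> 'I_m} | g < wt R (trace_edges E z)]|%:R.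
Proof.
move=> m0 cc EE g0 eps0 dens.
set D : R := d%:R * 2 ^+ d.-1; set T : R := #|{: _}|%:R.
set pi : R := \prod_(e in _) _; set k : R := #|cube_edges d|%:R.
have T0 : 0 <= T by rewrite ler0n.
have D0 : 0 <= D by rewrite mulr_ge0 ?exprn_ge0 ?ler0n.
have mR : 0 < m%:R ^+ 2 :> R by rewrite exprn_gt0 ?ltr0n.
pose es := enum (cube_edges d).
have esE e : (e \in es) = (e \in cube_edges d) by rewrite mem_enum.
pose r (e : cube d * cube d) (i j : 'I_m) := adj (e.1, i) (e.2, j).
pose X (z : {ffun cube d -> 'I_m}) := all_pairs r es z.
have sumX : \sum_z (X z)%:R <= pi * T + k * eps * T.
  have lexes : {in es, forall e, lexlt e.1 e.2} by move=> e; rewrite esE inE.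
  have := @replace_by_density R m d adj eps r es [::] m0 cc.
  rewrite cats0 => /(_ (enum_uniq _) lexes (fun e _ => erefl)).
  rewrite big_enum /= -cardE -/pi -/k -/T.
  have -> : \sum_(z : {ffun cube d -> 'I_m}) (all_pairs r [::] z)%:R = T.
    by rewrite /T -sumr_const; apply: eq_bigr.
  by rewrite ler_norml => /andP[_]; rewrite /X; lra.
pose Phi := \sum_z (X z)%:R * wt R (trace_edges E z).
have PhiU : Phi <= g * (pi * T + k * eps * T) +
    D * #|[set z : {ffun cube d -> 'I_m} | g < wt R (trace_edges E z)]|%:R.
  apply: (@le_trans _ _ (\sum_z (g * (X z)%:R + D *
     (g < wt R (trace_edges E z))%R%:R))).
    apply: ler_sum => z _; case: (X z); rewrite /= ?mul1r ?mulr1 ?mul0r ?mulr0.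
      case: ltP => h; last by rewrite mulr0 addr0.
      rewrite mulr1 ler_wpDl // /D -wt_cube_edges; apply: wt_subset.
      by apply/fintype.subsetP => e; rewrite inE => /andP[].
    by rewrite add0r mulr_ge0.
  rewrite big_split /= -!mulr_sumr -(sum_mem R (fun z => (g < wt R (trace_edges E z))%R)).
  by rewrite lerD2r ler_wpM2l.
have PhiL : pi * (g + gap) * T - D * (k * eps) * T <= Phi.
  have PhiE : Phi = \sum_(e in cube_edges d) edge_wt R e *
     \sum_z (X z && (((e.1, z e.1), (e.2, z e.2)) \in E))%:R.
    rewrite /Phi; under [RHS]eq_bigr do rewrite mulr_sumr.
    rewrite exchange_big /=; apply: eq_bigr => z _.
    rewrite /wt mulr_sumr [LHS]big_mkcond [RHS]big_mkcond /=.
    apply: eq_bigr => e _; rewrite inE; case: (e \in cube_edges d) => //=.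
    by case: (X z); case: (_ \in E); rewrite /= ?mul1r ?mul0r ?mulr0 ?mulr1.
  have term e : e \in cube_edges d ->
      pi * (#|cross_edges E e|%:R / m%:R ^+ 2 * T) - edge_wt R e * (k * eps * T)
      <= edge_wt R e *
     \sum_z (X z && (((e.1, z e.1), (e.2, z e.2)) \in E))%:R.
    move=> eC; have elt : lexlt e.1 e.2 by rewrite inE in eC.
    (* Since [E] lies in R(m,d), adjacency at [e] may be sharpened to membership in [E]; the
       constraints at all other pairs are replaced by their densities. *)
    pose rE (f : cube d * cube d) (i j : 'I_m) :=
      if f == e then ((e.1, i), (e.2, j)) \in E else r f i j.
    pose s := rem e es.
    have sP : perm_eq es (s ++ [:: e]).
      have eL : e \in es by rewrite esE.
      by rewrite (permPl (perm_to_rem eL)) -cat1s perm_catC.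
    have us : uniq (s ++ [:: e]) by rewrite -(perm_uniq sP) enum_uniq.
    have sE f : f \in s -> f != e.
      by rewrite mem_rem_uniq ?enum_uniq // !inE => /andP[].
    have := @replace_by_density R m d adj eps rE s [:: e] m0 cc us.
    rewrite -/T => H.
    have lexs : {in s ++ [:: e], forall f, lexlt f.1 f.2}.
      by move=> f; rewrite -(perm_mem sP) esE inE.
    have rs : {in s, forall f, rE f = fun i j => adj (f.1, i) (f.2, j)}.
      by move=> f /sE/negbTE fe; rewrite /rE fe.
    have {H} := H lexs rs.
    have -> : \sum_z (all_pairs rE (s ++ [:: e]) z)%:R =
      \sum_z (X z && (((e.1, z e.1), (e.2, z e.2)) \in E))%:R :> R.
      apply: eq_bigr => z _; congr (nat_of_bool _)%:R.
      rewrite /X /all_pairs (perm_all _ sP) !all_cat /= !andbT /rE eqxx.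
      rewrite (@eq_in_all _ _ (fun f => r f (z f.1) (z f.2))); last first.
        by move=> f /sE/negbTE->.
      rewrite -andbA; congr (_ && _); rewrite andbC.
      have [h|//] := boolP (_ \in E).
      by move/fintype.subsetP: EE => /(_ _ h); rewrite inE /r => /andP[_ /= ->].
    have -> : \sum_z (all_pairs rE [:: e] z)%:R =
        #|cross_edges E e|%:R / m%:R ^+ 2 * T.
      apply: (mulfI (lt0r_neq0 mR)); rewrite mulrA mulrCA mulfV ?lt0r_neq0 // mulr1.
      rewrite -(@sum_pair_indicator R m d e
        (fun i j => ((e.1, i), (e.2, j)) \in E)) ?lexlt_neq //.
      congr (_ * _); apply: eq_bigr => z _.
      by rewrite /all_pairs /= /rE eqxx andbT.
    have piE : pi = edge_wt R e * \prod_(f <- s) edge_wt R f.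
      by rewrite /pi -big_enum -/es (perm_big _ sP) big_cat big_seq1 mulrC.
    rewrite ler_norml => /andP[H _].
    have p0 := edge_wt_gt0 R e.
    rewrite piE -mulrA -mulrBr ler_pM2l //; move: H.
    have : (size s)%:R * eps * T <= k * eps * T.
      rewrite ler_wpM2r // ler_wpM2r // ler_nat cardE -/es size_rem ?esE //.
      exact: leq_pred.
    by lra.
  rewrite PhiE; apply: le_trans (ler_sum _ term).
  rewrite sumrB -mulr_suml -/(wt R _) wt_cube_edges -/D -mulr_sumr -mulr_suml.
  rewrite -mulr_suml -natr_sum (sum_cross_edges EE) !mulrA lerD2r.
  apply: ler_wpM2r => //; rewrite -mulrA; apply: ler_wpM2l.
    by apply: prodr_ge0 => e _; exact: ltW (edge_wt_gt0 R e).
  by rewrite ler_pdivlMr.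
by move: (le_trans PhiL PhiU); lra.
Qed.

(** * Finding copies of F *)

Lemma nth_enum_ord_lt (m : nat) (A : {set 'I_m}) (i0 : 'I_m) (i j : nat) :
  (i < j)%N -> (j < #|A|)%N -> (nth i0 (enum A) i < nth i0 (enum A) j)%N.
Proof.
move=> ij jA.
have srt : sorted (fun a b : 'I_m => (a < b)%N) (enum A).
  rewrite /enum_mem; apply: sorted_filter => [? ? ?|]; first exact: ltn_trans.
  by have := iota_ltn_sorted 0 m; rewrite -val_enum_ord sorted_map -enumT.
have tr : transitive (fun a b : 'I_m => (a < b)%N) by move=> ? ? ?; exact: ltn_trans.
by apply: (sorted_ltn_nth tr i0 srt) => //; rewrite inE -cardE // (ltn_trans ij).
Qed.

(** The vertex [a] of F goes to the element of [A (f a)] whose index is the rank of [a], so vertices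
    sharing a block are in the right order. *)
Lemma contains_of_box (W : finType) (ltF adjF : rel W) (m d : nat)
    (U : {set Vt m d}) (E : {set Vt m d * Vt m d}) (f : {ffun W -> cube d})
    (A : cube d -> {set 'I_m}) : is_ograph ltF adjF -> (0 < m)%N ->
  (forall x, #|A x| = #|W|) ->
  (forall z : {ffun cube d -> 'I_m}, (forall x, z x \in A x) ->
     weak_hom ltF adjF [set x | (x, z x) \in U] (trace_edges E z) f) ->
  contains_in ltF adjF (@vlt m d) U E.
Proof.
move=> og m0 cA hz; pose i0 := Ordinal m0.
pose el x a := nth i0 (enum (A x)) (rank_of ltF a).
have elA x a : el x a \in A x.
  by rewrite -mem_enum mem_nth // -cardE cA (rank_of_bound a og).
pose zof a : {ffun cube d -> 'I_m} := [ffun x => el x a].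
have zofA a x : zof a x \in A x by rewrite ffunE elA.
pose g a : Vt m d := (f a, el (f a) a).
have gU a : g a \in U.
  have /and3P[/forallP/(_ a) + _ _] := hz _ (zofA a).
  by rewrite inE ffunE.
have gl a b : ltF a b -> vlt (g a) (g b).
  move=> ab; have /and3P[_ /forallP/(_ a)/forallP/(_ b)/implyP/(_ ab) + _] :=
    hz _ (zofA a).
  rewrite /vlt /=; case/orP => [/eqP e|->//]; rewrite e eqxx /=.
  apply/orP; right; apply: nth_enum_ord_lt; first exact: rank_of_lt og ab.
  by rewrite cA (rank_of_bound b og).
have virr (u : Vt m d) : vlt u u = false by rewrite /vlt lexlt_irr ltnn andbF.
have gE a b : adjF a b -> adjE E (g a) (g b).
  (* A single transversal through both images; it exists because trace edges join distinct blocks,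
     so that [f a != f b]. *)
  move=> ab; pose z := upd (zof a) (f b) (el (f b) b).
  have zA x : z x \in A x.
    by rewrite ffunE; case: eqVneq => [->|_]; [exact: elA | exact: zofA].
  have /and3P[_ _ /forallP/(_ a)/forallP/(_ b)/implyP/(_ ab)] := hz _ zA.
  have zb : z (f b) = el (f b) b by rewrite upd_id.
  have za : f a != f b -> z (f a) = el (f a) a.
    by move=> ne; rewrite upd_neq // ffunE.
  case/orP; rewrite !inE /= => /andP[/lexlt_neq ne]; rewrite zb za //.
  - by move=> h; rewrite /adjE h.
  - by move=> h; rewrite /adjE h orbT.
  - by rewrite eq_sym.
apply/existsP; exists [ffun a => g a]; apply/and4P; split.
- apply/injectiveP => a b; rewrite !ffunE => e; apply/eqP.
  case: (og) => _ _ tot _ _; apply: contraT => /tot /orP[] /gl;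
  by rewrite e virr.
- by apply/forallP => a; rewrite ffunE.
- apply/forallP => a; apply/forallP => b; apply/implyP => ab.
  by rewrite !ffunE gl.
- apply/forallP => a; apply/forallP => b; apply/implyP => ab.
  by rewrite !ffunE gE.
Qed.

(** A trace heavier than the maximum is not free, hence admits a weakly monotone homomorphism. One
    map works for a positive share of the transversals, and [dense_box] finds a box among these. *)
Lemma contains_of_heavy (R : realType) (W : finType) (ltF adjF : rel W)
    (d : nat) (c : R) : is_ograph ltF adjF -> 0 < c ->
  exists M : nat, forall m : nat, (M <= m)%N ->
    forall (adj : rel (Vt m d)) (U : {set Vt m d}) (E : {set Vt m d * Vt m d}),
    is_subgraph (@vlt m d) adj U E ->
    c * #|{: {ffun cube d -> 'I_m}}|%:R <=
      #|[set z : {ffun cube d -> 'I_m} |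
           max_hom_free_wt R ltF adjF d < wt R (trace_edges E z)]|%:R ->
    contains_in ltF adjF (@vlt m d) U E.
Proof.
move=> og c0; pose k := #|{: {ffun W -> cube d}}|.
have k0 : 0 < k%:R :> R.
  by rewrite ltr0n; apply/card_gt0P; exists [ffun=> [ffun=> false]].
(* Pigeonhole over the [k] maps; the factor 2 gives room for a strict contradiction. *)
have c'0 : 0 < c / (2 * k%:R) by rewrite divr_gt0 // mulr_gt0.
have [M HM] := dense_box (cube d) #|W| c'0.
exists M.+1 => m Mm adj U E /andP[EE /forall_inP EU] good.
have m0 : (0 < m)%N by exact: leq_ltn_trans Mm.
have T0 : 0 < #|{: {ffun cube d -> 'I_m}}|%:R :> R.
  by rewrite ltr0n; apply/card_gt0P; exists [ffun=> Ordinal m0].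
pose Uz (z : {ffun cube d -> 'I_m}) := [set x | (x, z x) \in U].
pose S (f : {ffun W -> cube d}) :=
  [set z : {ffun cube d -> 'I_m} | weak_hom ltF adjF (Uz z) (trace_edges E z) f].
have goodS : (#|[set z : {ffun cube d -> 'I_m} |
    (max_hom_free_wt R ltF adjF d < wt R (trace_edges E z))%R]| <= \sum_f #|S f|)%N.
  rewrite -sum1_card; under [leqRHS]eq_bigr do rewrite -sum1dep_card.
  rewrite (exchange_big_dep predT) //= [leqLHS]big_mkcond /=.
  apply: leq_sum => z _; case: ifP => // /[!inE] zgood.
  have : ~~ hom_free ltF adjF (Uz z, trace_edges E z).
    apply: contraTN zgood => /(@le_max_hom_free_wt R) /=.
    by rewrite -leNgt.
  rewrite /hom_free /= !negb_and negbK => /or3P[/negP[]|/negP[]|/existsP[f fh]].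
  - by apply/fintype.subsetP => e; rewrite inE => /andP[].
  - by apply/forall_inP => e; rewrite !inE => /andP[_ /EU].
  by rewrite (bigD1 f).
have [f fS] : exists f, c / (2 * k%:R) * #|{: {ffun cube d -> 'I_m}}|%:R <= #|S f|%:R.
  apply/existsP; apply: contraT; rewrite negb_exists => /forallP small.
  have : \sum_f #|S f|%:R <=
     \sum_(f : {ffun W -> cube d}) c / (2 * k%:R) * #|{: {ffun cube d -> 'I_m}}|%:R.
    by apply: ler_sum => f _; apply/ltW; rewrite ltNge small.
  rewrite sumr_const -/k -[_ *+ k]mulr_natr -natr_sum.
  move: goodS; rewrite -(ler_nat R) => h1 h2.
  have := le_trans good (le_trans h1 h2).
  set T : R := #|_|%:R in T0 *.
  have -> : c / (2 * k%:R) * T * k%:R = c * T / 2 by field; rewrite gt_eqF.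
  by have := mulr_gt0 c0 T0; lra.
have [|A cA AS] := HM _ (S f) _ fS; first by rewrite card_ord ltnW.
apply: (contains_of_box (f := f) og m0 cA) => z /AS.
by rewrite inE.
Qed.

(** Projecting a copy of F in the blow-up to the cube gives a weakly monotone homomorphism, so the
    blow-up of a free pair is F-free. *)
Lemma blowup_edges_le (W : finType) (ltF adjF : rel W) (m d : nat)
    (adj : rel (Vt m d)) (UE : {set cube d} * {set cube d * cube d}) :
  hom_free ltF adjF UE ->
  (\sum_(e in UE.2) nedges_between adj e.1 e.2 finset.setT finset.setT <=
   max_free_edges ltF adjF (@vlt m d) adj)%N.
Proof.
case: UE => U E /and3P[/= EC /forall_inP EU nhom].
pose U' : {set Vt m d} := [set u | u.1 \in U].
pose E' := [set p in edgeset (@vlt m d) adj | (p.1.1, p.2.1) \in E].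
have EE' : E' \subset edgeset (@vlt m d) adj.
  by apply/fintype.subsetP => p; rewrite inE => /andP[].
apply: (@leq_trans #|E'|).
  apply: (@leq_trans (\sum_(e in cube_edges d) #|cross_edges E' e|)%N).
    rewrite [leqLHS]big_mkcond [leqRHS]big_mkcond /=; apply: leq_sum => -[x y] _.
    case: ifP => // eE; have /fintype.subsetP/(_ _ eE) eC := EC; rewrite eC.
    rewrite inE in eC; rewrite nedges_between_cross //.
    apply: subset_leq_card; apply/fintype.subsetP => ij; rewrite !inE /= => ->.
    by rewrite eE.
  rewrite (sum_cross_edges EE'); apply: subset_leq_card.
  by apply/fintype.subsetP => p; rewrite inE => /andP[].
apply: (@leq_bigmax_cond _ _
  (fun UE : {set Vt m d} * {set Vt m d * Vt m d} => #|UE.2|) (U', E')).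
apply/andP; split; first (apply/andP; split=> //).
  by apply/forall_inP => p; rewrite !inE => /andP[_ /EU].
apply: contra nhom => /existsP[f /and4P[_ /forallP fU /forallP fl /forallP fE]].
apply/existsP; exists [ffun a => (f a).1]; apply/and3P; split.
- by apply/forallP => a; have := fU a; rewrite inE ffunE.
- apply/forallP => a; apply/forallP => b; apply/implyP => ab.
  have /forallP/(_ b)/implyP/(_ ab) := fl a; rewrite !ffunE /vlt.
  by case/orP => [->|/andP[-> _]]; rewrite ?orbT.
apply/forallP => a; apply/forallP => b; apply/implyP => ab.
have /forallP/(_ b)/implyP/(_ ab) := fE a; rewrite !ffunE.
by case/orP; rewrite inE /= => /andP[_ h]; rewrite /adjE h ?orbT.
Qed.

(** * The limit in m *)

Lemma max_hom_free_wt_le (R : realType) (W : finType) (ltF adjF : rel W)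
    (d : nat) : max_hom_free_wt R ltF adjF d <= d%:R * 2 ^+ d.-1.
Proof.
have [->|[UE hf ->]] := max_hom_free_wtP R ltF adjF d.
  by rewrite mulr_ge0 ?exprn_ge0 ?ler0n.
by rewrite -wt_cube_edges; apply: wt_subset; case/and3P: hf.
Qed.

Lemma max_free_edges_ge (R : realType) (W : finType) (ltF adjF : rel W)
    (m d : nat) (adj : rel (Vt m d)) (eps : R) : 0 <= eps ->
  cut_close adj eps ->
  (max_hom_free_wt R ltF adjF d - #|cube_edges d|%:R * eps) * m%:R ^+ 2 <=
  (max_free_edges ltF adjF (@vlt m d) adj)%:R.
Proof.
move=> eps0 cc; have m0 : 0 <= m%:R ^+ 2 :> R by rewrite exprn_ge0 ?ler0n.
have [->|[UE hf ->]] := max_hom_free_wtP R ltF adjF d.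
  rewrite sub0r mulNr; apply: (@le_trans _ _ 0) => //.
  by rewrite oppr_le0 !mulr_ge0.
have /and3P[EC _ _] := hf.
have := blowup_edges_le adj hf; rewrite -(ler_nat R) natr_sum; apply: le_trans.
apply: (@le_trans _ _ (\sum_(e in UE.2) (edge_wt R e - eps) * m%:R ^+ 2)).
  rewrite -mulr_suml ler_wpM2r // sumrB lerD2l lerN2 sumr_const.
  by rewrite -[eps *+ _]mulr_natl ler_wpM2r // ler_nat subset_leq_card.
apply: ler_sum => -[x y] eE.
have xy : lexlt x y by have /fintype.subsetP/(_ _ eE) := EC; rewrite inE.
have := cc x y finset.setT finset.setT xy.
rewrite finset.cardsT card_ord ler_norml => /andP[+ _].
by rewrite mulrBl -mulrA -expr2; lra.
Qed.

Lemma free_edges_le (R : realType) (W : finType) (ltF adjF : rel W)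
    (d : nat) (gap : R) : is_ograph ltF adjF -> (0 < d)%N -> 0 < gap ->
  exists M : nat, exists2 eps : R, 0 < eps &
    forall m : nat, (M <= m)%N -> forall adj : rel (Vt m d),
    cut_close adj eps ->
    forall (U : {set Vt m d}) (E : {set Vt m d * Vt m d}),
    is_subgraph (@vlt m d) adj U E -> ~~ contains_in ltF adjF (@vlt m d) U E ->
    #|[set p in E | p.1.1 != p.2.1]|%:R <=
      (max_hom_free_wt R ltF adjF d + gap) * m%:R ^+ 2.
Proof.
move=> og d0 gap0; set mu := max_hom_free_wt _ _ _ _.
have mu0 : 0 <= mu by exact: max_hom_free_wt_ge0.
set D : R := d%:R * 2 ^+ d.-1.
have D0 : 0 < D by rewrite mulr_gt0 ?exprn_gt0 ?ltr0n.
set pi : R := \prod_(e in cube_edges d) edge_wt R e.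
have pi0 : 0 < pi by apply: prodr_gt0 => e _; exact: edge_wt_gt0.
have c0 : 0 < pi * gap / 2 / D by rewrite divr_gt0 // divr_gt0 // mulr_gt0.
have [M HM] := @contains_of_heavy R W ltF adjF d _ og c0.
set k : R := #|cube_edges d|%:R; have k0 : 0 <= k by rewrite ler0n.
have Q0 : 0 < (D + mu) * k + 1 by rewrite ltr_wpDl // mulr_ge0 // addr_ge0 // ltW.
(* Half of [pi * gap] absorbs the error [(D + mu) * k * eps] of [many_heavy_traces]; the summand 1
   keeps the denominator positive. *)
pose eps := pi * gap / 2 / ((D + mu) * k + 1).
have eps0 : 0 < eps by rewrite divr_gt0 // divr_gt0 // mulr_gt0.
exists M.+1, eps => // m Mm adj cc U E sub; apply: contraNT; rewrite -ltNge => /ltW dens.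
have /andP[EE _] := sub.
apply: (HM m (ltnW Mm) adj U E sub).
have m0 : (0 < m)%N by exact: leq_ltn_trans Mm.
have := many_heavy_traces m0 cc EE mu0 (ltW eps0) dens.
rewrite -/D -/pi -/k -/mu; set T : R := #|_|%:R; set G : R := #|_|%:R => H.
have T0 : 0 <= T by rewrite ler0n.
rewrite mulrAC ler_pdivrMr // mulrC [G * D]mulrC; apply: le_trans H.
rewrite mulrC ler_wpM2r //.
have : eps * ((D + mu) * k + 1) = pi * gap / 2 by rewrite /eps divfK // gt_eqF.
by move: eps0; lra.
Qed.

Lemma edges_split_blocks (m d : nat) (E : {set Vt m d * Vt m d}) :
  (#|[set p in E | p.1.1 != p.2.1]| + #|[set p in E | p.1.1 == p.2.1]| = #|E|)%N.
Proof.
rewrite -(cardsID [set p | p.1.1 != p.2.1] E); congr (_ + _)%N;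
  apply: eq_card => p; rewrite !inE //.
by rewrite negbK andbC.
Qed.

(** [max_free_edges_ge] and [free_edges_le] bound the extremal number from both sides. Edges inside
    blocks escape the cut norm, but the bounds on the total and on the levels make them negligible.
    The last conclusion lets R(m,d) compete in the infimum. *)
Lemma rho_limit (R : realType) (d : nat) (adj : forall m, rel (Vt m d))
  (adj_prop : forall eps : R, 0 < eps ->
     exists M : nat, forall m : nat, (M <= m)%N ->
       (forall l : nat, (1 <= l <= d)%N ->
          (1 - eps) * (2 ^+ d.-1 * m%:R ^+ 2) <= (nedges_level (adj m) l)%:R)
       /\ (nedges (@vlt m d) (adj m))%:R
            <= (1 + eps) * (d%:R * 2 ^+ d.-1 * m%:R ^+ 2)
       /\ (forall (x y : cube d) (P Q : {set 'I_m}), x != y ->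
             (m%:R `^ (2 / 3) <= #|P|%:R :> R) ->
             (m%:R `^ (2 / 3) <= #|Q|%:R :> R) ->
             (nedges_between (adj m) x y P Q)%:R
               <= (1 + eps) * (2 ^+ (delta x y) / 2 ^+ d) * #|P|%:R * #|Q|%:R))
  (W : finType) (ltF adjF : rel W) (og : is_ograph ltF adjF) (eps : R) :
  0 < eps -> exists M : nat, forall m : nat, (M <= m)%N ->
    `|max_hom_free_wt R ltF adjF d / (d%:R * 2 ^+ d.-1) -
      rho R ltF adjF (@vlt m d) (adj m)| <= eps /\
    ((0 < d)%N -> (0 < nedges (@vlt m d) (adj m))%N).
Proof.
move=> eps0; case: (posnP d) => [d0|d0].
  (* For [d = 0] there are no edges, and both quotients are 0 by division by zero. *)
  subst d; have [M HM] := adj_prop 1 ltr01; exists M => m /HM[_ [ne _]]; split=> //.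
  move: ne; rewrite /rho !mul0r mulr0 lern0 => /eqP->.
  by rewrite invr0 !mulr0 subrr normr0 ltW.
set D : R := d%:R * 2 ^+ d.-1; set mu := max_hom_free_wt _ _ _ _.
have D0 : 0 < D by rewrite mulr_gt0 ?exprn_gt0 ?ltr0n.
have mu0 : 0 <= mu by exact: max_hom_free_wt_ge0.
have muD : mu <= D by exact: max_hom_free_wt_le.
have gap0 : 0 < eps * D / 4 by apply: divr_gt0 => //; exact: mulr_gt0.
have [M1 [e1 e10 HM1]] := @free_edges_le R W ltF adjF d _ og d0 gap0.
set k : R := #|cube_edges d|%:R; have k0 : 0 <= k by rewrite ler0n.
pose Q := (2 * D + 2) * (k + 1).
have Q0 : 0 < Q by rewrite mulr_gt0 //; lra.
(* The first two bounds control the edge counts, the third gives [cut_close] with [e1] for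
   [free_edges_le], and the last makes the loss of the blow-up at most [eps * D / 2]. *)
pose e2 := Num.min (Num.min (1 / 4) (eps / 16))
   (Num.min (e1 / (2 * D + 2)) (eps * D / 2 / Q)).
have e20 : 0 < e2.
  have tD : 0 < 2 * D + 2 by lra.
  have e1D : 0 < e1 / (2 * D + 2) by exact: divr_gt0.
  have eQ : 0 < eps * D / 2 / Q by apply: divr_gt0 => //; lra.
  by rewrite !lt_min e1D eQ !andbT; apply/andP; split; lra.
have [e2a e2b e2c e2d] : [/\ e2 <= 1 / 4, e2 <= eps / 16, e2 <= e1 / (2 * D + 2) &
    e2 <= eps * D / 2 / Q].
  by split; rewrite /e2 !ge_min lexx ?orbT.
have [M2 HM2] := adj_prop e2 e20; have [M3 HM3] := powR_two_thirds_le e20.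
exists (M1 + M2 + M3).+1 => m Mm.
have m0 : (0 < m)%N by exact: leq_ltn_trans Mm.
have /andP[m12 m3] : (M1 + M2 <= m)%N && (M3 <= m)%N.
  by rewrite (leq_trans (leq_addr M3 _) (ltnW Mm)) (leq_trans (leq_addl _ M3) (ltnW Mm)).
have m1 : (M1 <= m)%N := leq_trans (leq_addr M2 M1) m12.
have m2 : (M2 <= m)%N := leq_trans (leq_addl M1 M2) m12.
have mR : 0 < m%:R ^+ 2 :> R by rewrite exprn_gt0 ?ltr0n.
have [lev [ne dens]] := HM2 m m2.
have e21 : e2 <= 1 by lra.
have [cc tot] := cut_close_of_upper e20 e21 (HM3 m m3) lev dens.
rewrite -/D in cc tot ne.
set E := edgeset (@vlt m d) (adj m).
have totE : \sum_(e in cube_edges d)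
    (nedges_between (adj m) e.1 e.2 finset.setT finset.setT)%:R =
    #|[set p in E | p.1.1 != p.2.1]|%:R :> R.
  rewrite -natr_sum -(sum_cross_edges (subxx E)); congr _%:R.
  by apply: eq_bigr => -[x y]; rewrite inE => /nedges_between_cross.
have nE : (nedges (@vlt m d) (adj m))%:R = #|[set p in E | p.1.1 != p.2.1]|%:R +
    #|[set p in E | p.1.1 == p.2.1]|%:R :> R.
  by rewrite -natrD edges_split_blocks.
rewrite totE in tot; set cr : R := #|[set p in E | p.1.1 != p.2.1]|%:R in tot nE.
set bl : R := #|[set p in E | p.1.1 == p.2.1]|%:R in nE.
have bl0 : 0 <= bl by rewrite ler0n.
set n : R := (nedges _ _)%:R in ne nE.
pose S := D * m%:R ^+ 2; have S0 : 0 < S by rewrite mulr_gt0.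
have tot' : (1 - e2) * S <= cr by rewrite /S mulrA.
have ne' : n <= (1 + e2) * S by [].
have n0 : 0 < n.
  have : 0 < (1 - e2) * S by rewrite mulr_gt0 //; lra.
  by lra.
split; last by move=> _; rewrite -(ltr_nat R).
set f : R := (max_free_edges ltF adjF (@vlt m d) (adj m))%:R.
rewrite /rho -/n -/f; set g := mu / D.
have g0 : 0 <= g by exact: divr_ge0 mu0 (ltW D0).
have g1 : g <= 1 by rewrite ler_pdivrMr // mul1r.
have muE : mu * m%:R ^+ 2 = g * S by rewrite /g /S; field; rewrite gt_eqF.
have e2S : 0 <= e2 * S by exact: mulr_ge0 (ltW e20) (ltW S0).
rewrite ler_norml; apply/andP; split.
  suff : f <= (g + eps) * n by rewrite -ler_pdivrMr //; lra.
  have cc1 : cut_close (adj m) e1.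
    move=> x y P P' xy; apply: le_trans (cc x y P P' xy) _.
    rewrite ler_wpM2r ?(ltW mR) //.
    by move: e2c; rewrite ler_pdivlMr; [rewrite mulrC | lra].
  have gS : (mu + eps * D / 4) * m%:R ^+ 2 = g * S + eps / 4 * S.
    by rewrite mulrDl muE /S; field.
  have k1 : g * (e2 * S) <= e2 * S by rewrite ler_piMl.
  have k2 : e2 * S <= eps / 16 * S by rewrite ler_wpM2r // ltW.
  have k3 : e2 * (eps * S) <= 1 / 4 * (eps * S).
    by rewrite ler_wpM2r // mulr_ge0 // ltW.
  have k4 : (g + eps) * ((1 - e2) * S) <= (g + eps) * n.
    by rewrite ler_wpM2l ?addr_ge0 ?(ltW eps0) //; lra.
  have k5 : 0 < eps * S by exact: mulr_gt0.
  (* The term [2 * (e2 * S)] bounds the edges inside blocks, as [n] is at most [(1 + e2) * S] and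
     the cross edges number at least [(1 - e2) * S]. *)
  have bound : g * S + eps / 4 * S + 2 * (e2 * S) <= (g + eps) * n by lra.
  apply: (@big_ind _ (fun j : nat => j%:R <= (g + eps) * n)).
  - exact: mulr_ge0 (addr_ge0 g0 (ltW eps0)) (ltW n0).
  - by move=> i j hi hj; case: (leqP i j) => h;
    rewrite ?(maxn_idPr _) ?(maxn_idPl _) // ltnW.
  case=> U E' /= /andP[sub nc].
  have := HM1 m m1 (adj m) cc1 U E' sub nc; rewrite -/mu gS => hc.
  have hb : #|[set p in E' | p.1.1 == p.2.1]|%:R <= bl.
    rewrite ler_nat; apply: subset_leq_card; apply/fintype.subsetP => p.
    rewrite !inE => /andP[pE ->]; rewrite andbT.
    by have /andP[/fintype.subsetP/(_ _ pE)] := sub; rewrite inE.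
  by rewrite -edges_split_blocks natrD; lra.
suff : (g - eps) * n <= f by rewrite -ler_pdivlMr //; lra.
have e3 : 0 <= (2 * D + 2) * e2 by apply: mulr_ge0; [lra | exact: ltW].
have := max_free_edges_ge ltF adjF e3 cc; rewrite -/mu -/k -/f.
have : k * ((2 * D + 2) * e2) <= eps * D / 2.
  move: e2d; rewrite ler_pdivlMr // /Q; apply: le_trans.
  have : 0 <= e2 * (2 * D + 2) by rewrite mulrC.
  by lra.
rewrite mulrBl muE => h1 h2.
have h3 : k * ((2 * D + 2) * e2) * m%:R ^+ 2 <= eps / 2 * S.
  have -> : eps / 2 * S = eps * D / 2 * m%:R ^+ 2 by rewrite /S; field.
  by rewrite ler_wpM2r // ltW.
have h4 : g * n <= g * ((1 + e2) * S) by rewrite ler_wpM2l.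
have h5 : g * (e2 * S) <= e2 * S by rewrite ler_piMl.
have h6 : e2 * S <= eps / 16 * S by rewrite ler_wpM2r // ltW.
have h7 : eps * ((1 - e2) * S) <= eps * n by apply: ler_wpM2l; [exact: ltW | lra].
have h8 : e2 * (eps * S) <= 1 / 4 * (eps * S) by rewrite ler_wpM2r // mulr_ge0 // ltW.
have h9 : 0 < eps * S by rewrite mulr_gt0.
by lra.
Qed.

(** * The limit in d *)

Unset Implicit Arguments.
Local Open Scope classical_set_scope.

Theorem theorem1p1 (R : realType)
  (Rg : forall m d : nat, rel (Vt m d))
  (Rg_sym : forall m d, symmetric (Rg m d))
  (Rg_irr : forall m d, irreflexive (Rg m d))
  (Rg_prop : forall (d : nat) (eps : R), 0 < eps ->
     exists M : nat, forall m : nat, (M <= m)%N ->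
       (* (i) *)
       (forall l : nat, (1 <= l <= d)%N ->
          (1 - eps) * (2 ^+ d.-1 * m%:R ^+ 2)
            <= (nedges_level (Rg m d) l)%:R
          /\ (nedges_level (Rg m d) l)%:R
            <= (1 + eps) * (2 ^+ d.-1 * m%:R ^+ 2))
       /\ (1 - eps) * (d%:R * 2 ^+ d.-1 * m%:R ^+ 2)
            <= (nedges (@vlt m d) (Rg m d))%:R
       /\ (nedges (@vlt m d) (Rg m d))%:R
            <= (1 + eps) * (d%:R * 2 ^+ d.-1 * m%:R ^+ 2)
       (* (ii) *)
       /\ (forall (x y : cube d) (P Q : {set 'I_m}), x != y ->
             (m%:R `^ (2 / 3) <= #|P|%:R :> R) ->
             (m%:R `^ (2 / 3) <= #|Q|%:R :> R) ->
             (nedges_between (Rg m d) x y P Q)%:R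
               <= (1 + eps) * (2 ^+ (delta x y) / 2 ^+ d) * #|P|%:R * #|Q|%:R))
  (W : finType) (ltW adjW : rel W) (HF : is_ograph ltW adjW) :
  exists g : nat -> R,
    (forall d : nat,
       (fun m : nat => rho R ltW adjW (@vlt m d) (Rg m d)) @ \oo --> g d)
    /\ g @ \oo --> rho_inf R ltW adjW.
Proof.
pose g d : R := max_hom_free_wt R ltW adjW d / (d%:R * 2 ^+ d.-1).
have lim d (eps : R) : 0 < eps -> exists M : nat, forall m : nat, (M <= m)%N ->
    `|g d - rho R ltW adjW (@vlt m d) (Rg m d)| <= eps /\
    ((0 < d)%N -> (0 < nedges (@vlt m d) (Rg m d))%N).
  apply: (@rho_limit R d (fun m => Rg m d) _ W ltW adjW HF) => e e0.
  have [M HM] := Rg_prop d e e0; exists M => m /HM[lev [_ [ne dens]]].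
  by split=> // l /lev[].
pose S := [set r : R | exists (V : finType) (lt adj : rel V),
  [/\ is_ograph lt adj, (0 < nedges lt adj)%N & r = rho R ltW adjW lt adj]].
have Srho m d : (0 < nedges (@vlt m d) (Rg m d))%N ->
    S (rho R ltW adjW (@vlt m d) (Rg m d)).
  move=> ne; exists (Vt m d), (@vlt m d), (Rg m d).
  by split=> //; apply: vlt_ograph.
have Slb : lbound S 0.
  by move=> r [V [lt [adj [_ _ ->]]]]; rewrite /rho divr_ge0 ?ler0n.
(* The graph R(m,1) with [m] large shows that the infimum runs over a nonempty set. *)
have Sinf : has_inf S.
  split; last by exists 0.
  have [M HM] := lim 1%N 1 ltr01; have [_ /(_ isT) ne] := HM M (leqnn M).
  by eexists; apply: Srho ne.
exists g; split.
  move=> d; apply/cvgrPdist_le => eps /lim - /(_ d)[M HM].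
  by exists M => // m /= /HM[].
apply/cvgrPdist_le => eps eps0; have e2 : 0 < eps / 2 by rewrite divr_gt0.
(* A graph within [eps / 2] of the infimum; embedding it in the cube bounds [g d] from above for
   large [d]. *)
have [r [V [lt [adj [og ne ->]]]] rlt] := inf_adherent e2 Sinf.
have [D HD] := @max_hom_free_wt_le_rho R W V ltW adjW lt adj _ og ne e2.
exists D.+1 => // d /= Dd.
have d0 : (0 < d)%N by exact: leq_ltn_trans Dd.
have dR : 0 < d%:R * 2 ^+ d.-1 :> R by rewrite mulr_gt0 ?exprn_gt0 ?ltr0n.
have gle : g d <= rho R ltW adjW lt adj + eps / 2.
  by rewrite /g ler_pdivrMr //; apply: HD; exact: ltnW.
(* For [d > 0], [g d] is a limit of densities over which the infimum is taken. *)
have gge : rho_inf R ltW adjW <= g d.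
  apply/ler_addgt0Pr => e e0; have [M HM] := lim d e e0.
  have [dist /(_ d0)/Srho Sm] := HM M (leqnn M).
  apply: (le_trans (ge_inf (ex_intro _ 0 Slb) Sm)).
  by move: dist; rewrite ler_norml => /andP[]; lra.
have : rho R ltW adjW lt adj < rho_inf R ltW adjW + eps / 2 by exact: rlt.
by rewrite ler_norml => h; apply/andP; split; lra.
Qed.
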